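(* For all positive integers $q,m$, \[ q^{\frac{1}{2m}-\frac{1}{2}} \geq K(\mathcal{A}_{qm}). \] Moreover, as $d\to\infty$, \[ K(\mathcal{A}_d) \leq e^{1/2} \sqrt{\frac{\log d }{d}}\,\exp\left(O\left(\frac{1}{\log d}\right)\right), \] and \[ 1 \leq \liminf_{d\to \infty} \frac{K(\mathcal{A}_d)}{\sqrt{\frac{\log d }{d}}} \leq \limsup_{d\to \infty} \frac{K(\mathcal{A}_d)}{\sqrt{\frac{\log d }{d}}} \leq e^{1/2}. \]
   Context: $\mathbb{D}^d=\{z=(z_1,\dots,z_d)\in\mathbb{C}^d: |z_1|,\dots,|z_d|<1\}$ is the open unit polydisk. The Schur class $\mathcal{S}_d$ is the set of all analytic $f:\mathbb{D}^d\to\overline{\mathbb{D}}$, where $\overline{\mathbb D}$ is the closed unit disk. The (Schur-)Agler class $\mathcal{A}_d$ is the set of all $f\in\mathcal{S}_d$ such that $\|f(T_1,\dots,T_d)\|\leq 1$ (operator norm) for all $d$-tuples $T=(T_1,\dots,T_d)$ of pairwise commuting strictly contractive operators ($\|T_j\|<1$) on a common complex Hilbert space; here, if $f(z)=\sum_{\alpha\in\mathbb{N}^d} f_\alpha z^\alpha$, then $f(T)=\sum_\alpha f_\alpha T^\alpha$, with $T^\alpha=T_1^{\alpha_1}\cdots T_d^{\alpha_d}$ and $\mathbb{N}$ including $0$. For $f(z)=\sum_\alpha f_\alpha z^\alpha$ set $\|f\|_1=\sum_\alpha|f_\alpha|$, and for $0<r<1$ set $f_r(z)=f(rz)$. The Bohr-Agler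 radius is $K(\mathcal{A}_d)=\sup\{r\in(0,1): \|f_r\|_1\leq 1 \text{ for all } f\in\mathcal{A}_d\}$. *)

(* Defs.v *)
From HB Require Import structures.
From mathcomp Require Import all_boot all_order all_algebra finmap.
From mathcomp Require Import complex.
From mathcomp Require Import all_classical all_reals all_analysis.

Set Implicit Arguments.
Unset Strict Implicit.
Unset Printing Implicit Defensive.

Import Order.TTheory GRing.Theory Num.Theory.
Import numFieldNormedType.Exports.

Local Open Scope classical_set_scope.
Local Open Scope ring_scope.

(* [normc : R[i] -> R] is the real-valued modulus. *)
Notation normc := ComplexField.Normc.normc.

Notation multi_index d := {ffun 'I_d -> nat}.

(* Unordered convergence (along the net of finite index sets) of the family F
   to s, for a possibly infinite length function N on V. *)
Definition has_sum (R : realType) (I : choiceType) (V : zmodType)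
    (N : V -> \bar R) (F : I -> V) (s : V) : Prop :=
  forall e : R, 0 < e ->
    exists J0 : {fset I}, forall J : {fset I}, (J0 `<=` J)%fset ->
      (N (s - \sum_(i <- J) F i)%R < e%:E)%E.

Section Analytic.
Variables (R : realType) (d : nat).
Implicit Types (f : 'rV[R[i]]_d -> R[i]) (c : multi_index d -> R[i]).

Definition polydisk : set 'rV[R[i]]_d :=
  [set z | forall j, normc (z 0 j) < 1].

Definition monomial (z : 'rV[R[i]]_d) (a : multi_index d) : R[i] :=
  \prod_(j < d) z 0 j ^+ a j.

Definition power_series_at f (w : 'rV[R[i]]_d) c : Prop :=
  exists2 e : R, 0 < e &
    forall z : 'rV[R[i]]_d, (forall j, normc (z 0 j - w 0 j) < e) ->
      has_sum (fun x => (normc x)%:E) (fun a => c a * monomial (z - w) a) (f z).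

Definition analytic_on_polydisk f : Prop :=
  forall w, polydisk w -> exists c, power_series_at f w c.

(* The values of f outside the polydisk are irrelevant here and below. *)
Definition schur_class : set ('rV[R[i]]_d -> R[i]) :=
  [set f | analytic_on_polydisk f /\ forall z, polydisk z -> normc (f z) <= 1].

(* The coefficients f_a of the expansion f(z) = \sum_a f_a z^a at 0. For f
   analytic they exist, are unique, and the expansion is valid on the whole
   polydisk. *)
Definition coef f : multi_index d -> R[i] :=
  xget (fun=> 0) [set c | power_series_at f 0 c].

Definition norm1 f : \bar R := (\esum_(a in [set: multi_index d]) (normc (coef f a))%:E)%E.

Definition dilate (r : R) f : 'rV[R[i]]_d -> R[i] :=
  fun z => f (real_complex R r *: z).

End Analytic.

Section Hilbert.
Variable R : realType.

Definition dot_norm (H : lmodType R[i]) (dot : {dot H for Num.conj}) (x : H) : R :=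
  Num.sqrt (complex.Re (dot x x)).

Definition dot_complete (H : lmodType R[i]) (dot : {dot H for Num.conj}) : Prop :=
  forall u : nat -> H,
    (forall e : R, 0 < e -> exists n0 : nat, forall m n : nat,
       (n0 <= m)%N -> (n0 <= n)%N -> dot_norm dot (u m - u n) < e) ->
    exists x : H, forall e : R, 0 < e -> exists n0 : nat, forall n : nat,
       (n0 <= n)%N -> dot_norm dot (u n - x) < e.

Record hilbertType := Hilbert {
  hilbert_sort :> lmodType R[i];
  hdot : {dot hilbert_sort for Num.conj};
  hilbert_complete : dot_complete hdot }.

Definition hnorm (H : hilbertType) (x : H) : R := dot_norm (hdot H) x.

(* Operator norm, equal to +oo when A is unbounded. *)
Definition opnorm (H : hilbertType) (A : H -> H) : \bar R :=
  ereal_sup [set (hnorm (A x))%:E | x in [set x | hnorm x <= 1]].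

Definition op_monomial (H : hilbertType) (d : nat) (T : 'I_d -> {linear H -> H})
    (a : multi_index d) : H -> H :=
  \big[comp/id]_(j < d) iter (a j) (T j).

(* A = f(T): the series \sum_a f_a T^a converges to A in operator norm. *)
Definition op_eval (H : hilbertType) (d : nat) (f : 'rV[R[i]]_d -> R[i])
    (T : 'I_d -> {linear H -> H}) (A : {linear H -> H}) : Prop :=
  has_sum (@opnorm H) (fun a => (fun x : H => coef f a *: op_monomial T a x) : H -> H)
    (A : H -> H).

End Hilbert.

(* For f in the Schur class and strict contractions T_j the series f(T) always
   converges, so asking for the existence of f(T) is no restriction. *)
Definition agler_class (R : realType) (d : nat) : set ('rV[R[i]]_d -> R[i]) :=
  [set f | schur_class f /\
    forall (H : hilbertType R) (T : 'I_d -> {linear H -> H}),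
      (forall i j x, T i (T j x) = T j (T i x)) ->
      (forall j, (opnorm (T j) < 1)%E) ->
      exists2 A : {linear H -> H}, op_eval f T A & (opnorm A <= 1)%E].

Definition bohr_agler_radius (R : realType) (d : nat) : R :=
  sup [set r : R | 0 < r < 1 /\
    forall f : 'rV[R[i]]_d -> R[i], agler_class f -> (norm1 (dilate r f) <= 1)%E].

(* Main.v *)
From HB Require Import structures.
Require Import Defs.
From mathcomp Require Import all_boot all_order all_algebra.
From mathcomp Require Import all_classical all_reals all_analysis.
From mathcomp Require separable cyclic cyclotomic.
From mathcomp Require Import finmap complex ring lra zify.

(** The theorem follows from a two-sided estimate of the radius, one test object
    for each side.

    Lower bound. Let [f] be in the Agler class with coefficients [f_a], and let
    [K^2] bound the number of multi-indices of degree [m]. Then [coef_bound]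
    says that the sum of [|f_a|] over [|a| = m + 1] is at most
    [K (1 - |f_0|^2)]. The reason is a single tuple of commuting contractions:
    multishifts on the monomials of degree at most [m], followed by a collapse
    of degree [m + 1] onto one unit vector [y], with weights [1 / K] and phases
    chosen so that the entry of [f(T)] from the constant monomial to [y] is
    exactly the sum of the [|f_a|] divided by [K]. Cauchy-Schwarz makes the
    collapse contractive. The compression of [f(T)] to the constant monomial
    and [y] is a contraction with diagonal [(f_0, f_0)], which yields the factor
    [1 - |f_0|^2]. The number of multi-indices of degree [m] is at most
    [s^(-m) (1 - s)^(-d)] for every [s] in [(0, 1)], so summing over the degrees
    is summing a geometric series, and the choice
    [r = (1 - eps) sqrt (ln d / d)], [s = r^2 / (1 - eps)] makes the total at
    most [|f_0| + (1 - |f_0|^2) / 2 <= 1] for large [d]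
    ([bohr_agler_radius_lower]).

    Upper bound. For [q m <= d] multiply [m] diagonal matrices of [q] fresh
    variables each, interlaced with the unitary matrix of the discrete Fourier
    transform. An entry of this product applied to a constant unit vector is a
    homogeneous polynomial of degree [m] with [q^m] monomials, all with
    coefficients of modulus [q^(-(m + 1) / 2)]. It is in the Agler class, because
    substituting commuting contractions gives a product of contractions. Hence
    [r^m q^((m - 1) / 2) <= 1] for every admissible [r]
    ([bohr_agler_radius_powR]); the choice [m] close to [ln d] and [q] close to
    [d / m] gives the asymptotic bound ([bohr_agler_radius_upper]).

    Both sides read coefficients off a function through [coef], which chooses
    some power series at the origin. That there is only one
    ([power_series_coef_uniq]) comes from averaging over grids of roots of
    unity. *)

Set Implicit Arguments.
Unset Strict Implicit.
Unset Printing Implicit Defensive.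

Import Order.TTheory GRing.Theory Num.Theory.
Import numFieldNormedType.Exports.
Local Open Scope classical_set_scope.
Local Open Scope ring_scope.

(** * The complex modulus *)

Section Modulus.
Variable R : realType.
Local Notation C := R[i].

Lemma normcE_norm (x : C) : `|x| = real_complex R (normc x).
Proof. by case: x. Qed.

Lemma normc_ge0 (x : C) : 0 <= normc x.
Proof. by case: x => a b; exact: sqrtr_ge0. Qed.

Lemma normc_prod (I : Type) (s : seq I) (P : pred I) (F : I -> C) :
  normc (\prod_(i <- s | P i) F i) = \prod_(i <- s | P i) normc (F i).
Proof.
apply: (big_morph (@normc R)) => [x y|].
  exact: ComplexField.Normc.normcM.
exact: ComplexField.Normc.normc1.
Qed.

Lemma normcX (x : C) n : normc (x ^+ n) = normc x ^+ n.
Proof. by rewrite -[n]card_ord -!prodr_const normc_prod. Qed.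

Lemma ler_normc_sum (I : Type) (s : seq I) (P : pred I) (F : I -> C) :
  normc (\sum_(i <- s | P i) F i) <= \sum_(i <- s | P i) normc (F i).
Proof.
apply: (big_ind2 (fun x y => normc x <= y)) => //.
  by rewrite ComplexField.Normc.normc0.
move=> x x' y y' h h'; apply: le_trans (le_normcD _ _) _; exact: lerD.
Qed.

Lemma normc_real (x : R) : normc (real_complex R x) = `|x|.
Proof. by rewrite /= expr0n /= addr0 sqrtr_sqr. Qed.

Lemma ler_normc_Re (x : C) : `|complex.Re x| <= normc x.
Proof. by rewrite -lecR -normcE_norm normc_ge_Re. Qed.

Lemma ler_normc_Im (x : C) : `|complex.Im x| <= normc x.
Proof.
case: x => a b /=; rewrite -sqrtr_sqr ler_wsqrtr // lerDr; exact: sqr_ge0.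
Qed.

Lemma ler_normc_ReIm (x : C) : normc x <= `|complex.Re x| + `|complex.Im x|.
Proof.
case: x => a b /=; rewrite -[leRHS]ger0_norm ?addr_ge0 // -sqrtr_sqr.
rewrite ler_wsqrtr // sqrrD !real_normK ?num_real // lerD2r lerDl.
by rewrite mulrn_wge0 // mulr_ge0.
Qed.

Lemma normc_eq0_small (x : C) : (forall e : R, 0 < e -> normc x <= e) -> x = 0.
Proof.
move=> h; apply: (@ComplexField.Normc.eq0_normc R); apply/eqP.
rewrite eq_le normc_ge0 andbT; apply/ler_addgt0Pr => e e0.
by rewrite add0r; exact: h.
Qed.

Lemma complex_Re_sum (I : Type) (s : seq I) (P : pred I) (F : I -> C) :
  complex.Re (\sum_(i <- s | P i) F i) = \sum_(i <- s | P i) complex.Re (F i).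
Proof. by apply: (big_morph (@complex.Re R)) => // -[a b] [a' b']. Qed.

Lemma complex_Im_sum (I : Type) (s : seq I) (P : pred I) (F : I -> C) :
  complex.Im (\sum_(i <- s | P i) F i) = \sum_(i <- s | P i) complex.Im (F i).
Proof. by apply: (big_morph (@complex.Im R)) => // -[a b] [a' b']. Qed.

End Modulus.

(** * Roots of unity *)

Section RootsOfUnity.
Variable R : realType.
Local Notation C := R[i].

Lemma complex_prim_root_exists n : (0 < n)%N -> {z : C | n.-primitive_root z}.
Proof.
move=> n_gt0; have [rs] := closed_field_poly_normal ('X^n - 1 : {poly C}).
rewrite (monicP (monicXnsubC 1 n_gt0)) scale1r => rsE; apply/sigW.
have /hasP[z _ pz] : has n.-primitive_root rs; last by exists z.
apply: cyclic.has_prim_root => //.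
- by apply/allP => z; rewrite -root_prod_XsubC -rsE.
- rewrite -separable.separable_prod_XsubC -rsE.
  by rewrite cyclotomic.separable_Xn_sub_1 // pnatr_eq0 -lt0n.
- by rewrite -ltnS -(size_prod_XsubC rs id) -rsE size_XnsubC.
Qed.

Lemma normc_prim_root n (z : C) : n.-primitive_root z -> normc z = 1.
Proof.
move=> pz; have n0 := prim_order_gt0 pz.
apply/eqP; rewrite -(@pexpr_eq1 _ _ n) // ?normc_ge0 // -normcX.
by rewrite (prim_expr_order pz) ComplexField.Normc.normc1.
Qed.

Lemma sum_prim_root n (z : C) k : n.-primitive_root z ->
  \sum_(i < n) (z ^+ k) ^+ i = if (n %| k)%N then n%:R else 0.
Proof.
move=> pz; case: ifPn => [|nk].
  rewrite (prim_order_dvd pz) => /eqP ->.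
  under eq_bigr do rewrite expr1n.
  by rewrite sumr_const card_ord.
have zk1 : z ^+ k - 1 != 0.
  by rewrite subr_eq0 -(prim_order_dvd pz).
apply: (mulfI zk1); rewrite mulr0 -subrX1 -exprM mulnC exprM.
by rewrite (prim_expr_order pz) expr1n subrr.
Qed.
End RootsOfUnity.

(** * Unordered sums *)

Section AbsoluteSummability.
Variable R : realType.
Local Notation C := R[i].

Lemma sum_abs_le (I : choiceType) (g : I -> R) (K : {fset I}) (e : R) :
  (forall K' : {fset I}, (K' `<=` K)%fset -> `|\sum_(i <- K') g i| <= e) ->
  \sum_(i <- K) `|g i| <= 2 * e.
Proof.
move=> h; rewrite (bigID (fun i => 0 <= g i)) /= mulr_natl mulr2n.
have hP (P : pred I) : `|\sum_(i <- K | P i) g i| <= e.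
  rewrite big_fset_condE; apply: h.
  by apply/fsubsetP => x; rewrite !inE => /andP[].
apply: lerD.
  rewrite (eq_bigr g) => [|i /ger0_norm //].
  exact: le_trans (ler_norm _) (hP _).
rewrite (eq_bigr (fun i => - g i)) => [|i]; last first.
  by rewrite -ltNge => /ltr0_norm.
rewrite sumrN; apply: le_trans (ler_norm _) _; rewrite normrN; exact: hP.
Qed.

Lemma fset_sumU (V : zmodType) (I : choiceType) (F : I -> V) (A B : {fset I}) :
  [disjoint A & B]%fset ->
  \sum_(i <- (A `|` B)%fset) F i = \sum_(i <- A) F i + \sum_(i <- B) F i.
Proof.
move=> dAB; rewrite (big_fsetID _ (mem A)) /=; congr (_ + _).
  by apply: eq_fbigl => i; rewrite !inE /= andb_orl andbb; case: (i \in A); rewrite ?andbF.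
apply: eq_fbigl => i; rewrite !inE /=.
case iB: (i \in B); rewrite ?andbT ?orbT ?orbF.
  by move: dAB; rewrite fdisjoint_sym => /fdisjointP /(_ i iB) /negbTE ->.
by case: (i \in A).
Qed.

(** Unordered convergence in the complex plane is absolute: a finite sum off
    [J0] is a difference of two partial sums beyond [J0], and a family all of
    whose finite subsums are small has a small sum of moduli, as one sees on
    the positive and negative parts of its real and imaginary parts. *)
Lemma has_sum_small_tail (I : choiceType) (F : I -> C) (s : C) :
  has_sum (fun x => (normc x)%:E) F s -> forall e : R, 0 < e ->
  exists J0 : {fset I}, forall K : {fset I}, [disjoint J0 & K]%fset ->
    \sum_(i <- K) normc (F i) <= e.
Proof.
move=> hs e e0; have e8 : 0 < e / 8 by rewrite divr_gt0.
have [J0 hJ0] := hs _ e8; exists J0 => K dK.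
have small (K' : {fset I}) : (K' `<=` K)%fset ->
    normc (\sum_(i <- K') F i) <= e / 4.
  move=> sK; have dK' : [disjoint J0 & K']%fset by exact: fdisjointWr dK.
  have h1 := hJ0 _ (fsubset_refl _).
  have h2 := hJ0 _ (fsubsetUl J0 K'); rewrite !lte_fin in h1 h2.
  have -> : \sum_(i <- K') F i =
     (s - \sum_(i <- J0) F i) - (s - \sum_(i <- (J0 `|` K')%fset) F i).
    by rewrite fset_sumU //; ring.
  apply: le_trans (le_normcD _ _) _; rewrite normcN.
  by apply: le_trans (lerD (ltW h1) (ltW h2)) _; lra.
have hRe : \sum_(i <- K) `|complex.Re (F i)| <= 2 * (e / 4).
  apply: sum_abs_le => K' sK'; apply: le_trans (small _ sK').
    by rewrite -complex_Re_sum; exact: ler_normc_Re.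
have hIm : \sum_(i <- K) `|complex.Im (F i)| <= 2 * (e / 4).
  apply: sum_abs_le => K' sK'; apply: le_trans (small _ sK').
  by rewrite -complex_Im_sum; exact: ler_normc_Im.
apply: (@le_trans _ _ (\sum_(i <- K) (`|complex.Re (F i)| + `|complex.Im (F i)|))).
  by apply: ler_sum => i _; exact: ler_normc_ReIm.
rewrite big_split /=; apply: le_trans (lerD hRe hIm) _; lra.
Qed.
End AbsoluteSummability.

(** * Uniqueness of power series coefficients *)

Section MultiIndex.
Variables (R : realType) (d : nat).
Local Notation C := R[i].

Definition mdeg (a : multi_index d) : nat := (\sum_(j < d) a j)%N.

Lemma leq_mdeg (a : multi_index d) j : (a j <= mdeg a)%N.
Proof. by rewrite /mdeg (bigD1 j) //= leq_addr. Qed.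

Lemma monomialZ (k : C) (z : 'rV[C]_d) (a : multi_index d) :
  monomial (k *: z) a = k ^+ mdeg a * monomial z a.
Proof.
rewrite /monomial; under eq_bigr do rewrite mxE exprMn.
by rewrite big_split /= prodrXr.
Qed.

Lemma normc_monomial (z : 'rV[C]_d) (a : multi_index d) (r : R) :
  (forall j, normc (z 0 j) = r) -> normc (monomial z a) = r ^+ mdeg a.
Proof.
move=> h; rewrite normc_prod; under eq_bigr do rewrite normcX h.
by rewrite prodrXr.
Qed.

End MultiIndex.

Lemma dvdn_shift_eq (N x y : nat) :
  (x < N -> y < N -> N %| N - x + y -> y = x)%N.
Proof.
by move=> xN yN /dvdnP [[|[|k]]]; rewrite ?mulSn; lia.
Qed.

Section Uniqueness.
Variables (R : realType) (d : nat).
Local Notation C := R[i].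

(** Orthogonality of characters on the finite torus of [N]-th roots of unity;
    it replaces integration over the torus in Cauchy's formula. *)
Lemma torus_grid_sum N (w : C) (e : 'I_d -> nat) : N.-primitive_root w ->
  \sum_(g : {ffun 'I_d -> 'I_N}) \prod_(j < d) (w ^+ g j) ^+ e j
  = if [forall j, (N %| e j)%N] then N%:R ^+ d else 0.
Proof.
move=> pw; rewrite -(bigA_distr_bigA (fun j (i : 'I_N) => (w ^+ i) ^+ e j)).
under eq_bigr => j _.
  under eq_bigr do rewrite -exprM mulnC exprM.
  rewrite sum_prim_root //; over.
case: ifPn => [/forallP h|/forallPn [j hj]].
  under eq_bigr do rewrite h.
  by rewrite prodr_const card_ord.
by rewrite (bigD1 j) //= (negbTE hj) mul0r.
Qed.

(** Averaging the series against a character over the grid of [N]-th roots of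
    unity, scaled to radius [rho], isolates the terms whose index is congruent
    to [a0] modulo [N]. The averages are small because each grid point is a
    point where the sum is 0, and for large [N] the other surviving terms lie
    in the tail of an absolutely convergent series. The tail set must be fixed
    before [N], which is why absolute convergence at the single point [z0]
    is needed: it controls all the grid points at once. *)
Lemma zero_power_series (b : multi_index d -> C) (e : R) : 0 < e ->
  (forall z : 'rV[C]_d, (forall j, normc (z 0 j) < e) ->
    has_sum (fun x => (normc x)%:E) (fun a => b a * monomial z a) 0) ->
  forall a, b a = 0.
Proof.
move=> e0 hb a0; set rho := e / 2.
have rho0 : 0 < rho by rewrite divr_gt0.
have rhoe : rho < e by rewrite /rho; lra.
set z0 : 'rV[C]_d := \row_j real_complex R rho.
have nz0 j : normc (z0 0 j) = rho by rewrite mxE normc_real gtr0_norm.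
set F := fun a => b a * monomial z0 a.
suff F0 : F a0 = 0.
  have mon0 : monomial z0 a0 != 0.
    apply/eqP => /(congr1 (@normc R)); rewrite (normc_monomial _ nz0).
    rewrite ComplexField.Normc.normc0 => /eqP.
    by rewrite expf_eq0 (gt_eqF rho0) andbF.
  by apply: (mulIf mon0); rewrite mul0r.
apply: normc_eq0_small => eps eps0; have eps2 : 0 < eps / 2 by rewrite divr_gt0.
have [|J0 hJ0] := has_sum_small_tail (hb z0 _) eps2.
  by move=> j; rewrite nz0.
(* [N] exceeds every entry of [a0] and of the indices in [J0], so that [a0] is
   the only index of [a0 |` J0] in its class modulo [N]. *)
set N := (\sum_(a <- (a0 |` J0)%fset) mdeg a).+1.
have ltN (a : multi_index d) j : a \in (a0 |` J0)%fset -> (a j < N)%N.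
  move=> aJ; rewrite ltnS; apply: leq_trans (leq_mdeg a j) _.
  by rewrite (big_fsetD1 a) //= leq_addr.
have [w pw] := complex_prim_root_exists R (ltn0Sn _ : (0 < N)%N).
have nw : normc w = 1 := normc_prim_root pw.
set zg := fun g : {ffun 'I_d -> 'I_N} => real_complex R rho *: (\row_j w ^+ g j) : 'rV[C]_d.
have nzg g j : normc (zg g 0 j) = rho.
  rewrite !mxE ComplexField.Normc.normcM normcX nw expr1n mulr1.
  by rewrite normc_real gtr0_norm.
have /choice [Jg hJg] : forall g : {ffun 'I_d -> 'I_N},
    exists J1 : {fset multi_index d}, forall J : {fset multi_index d},
    (J1 `<=` J)%fset -> normc (\sum_(a <- J) b a * monomial (zg g) a) < eps / 2.
  move=> g; have [|J hJ] := hb (zg g) _ _ eps2.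
    by move=> j; rewrite nzg.
  by exists J => J' /hJ; rewrite lte_fin sub0r normcN.
set J := ((a0 |` J0) `|` \big[fsetU/fset0]_(g : {ffun 'I_d -> 'I_N}) Jg g)%fset.
have JgJ g : (Jg g `<=` J)%fset.
  apply: fsubset_trans (fsubsetUr _ _); exact: bigfcup_sup.
have a0J : a0 \in J by rewrite !inE eqxx.
(* As [w ^+ N = 1], multiplying by a power [N - a0 j] of a root of unity is
   dividing by its power [a0 j], without leaving natural exponents. *)
pose eqv (a : multi_index d) := [forall j, (N %| N - a0 j + a j)%N].
have eqv0 : eqv a0.
  apply/forallP => j; rewrite subnK ?dvdnn // ltnW // ltN //.
  by rewrite !inE eqxx.
have eqvP a : a \in (a0 |` J0)%fset -> eqv a -> a = a0.
  move=> aJ /forallP h; apply/ffunP => j.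
  have := h j; have := ltN a j aJ.
  have := ltN a0 j; rewrite !inE eqxx => /(_ isT).
  exact: dvdn_shift_eq.
have hsum : \sum_(g : {ffun 'I_d -> 'I_N})
     (\prod_(j < d) (w ^+ g j) ^+ (N - a0 j)) *
     (\sum_(a <- J) b a * monomial (zg g) a)
   = N%:R ^+ d * \sum_(a <- J | eqv a) F a.
  under eq_bigr do rewrite mulr_sumr.
  rewrite exchange_big /= [in RHS]big_mkcond /= mulr_sumr; apply: eq_bigr => a _.
  have hF : F a = b a * real_complex R rho ^+ mdeg a.
    rewrite /F /monomial; congr (_ * _).
    by under eq_bigr do rewrite mxE; rewrite prodrXr.
  have hg (g : {ffun 'I_d -> 'I_N}) :
      (\prod_(j < d) (w ^+ g j) ^+ (N - a0 j)) * (b a * monomial (zg g) a)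
      = F a * \prod_(j < d) (w ^+ g j) ^+ (N - a0 j + a j).
    under [in RHS]eq_bigr do rewrite exprD.
    rewrite big_split /= hF monomialZ /monomial.
    have -> : \prod_(j < d) (\row_j w ^+ g j : 'rV[C]_d) 0 j ^+ a j
              = \prod_(j < d) (w ^+ g j) ^+ a j.
      by apply: eq_bigr => j _; rewrite mxE.
    by ring.
  rewrite (eq_bigr _ (fun g _ => hg g)) -mulr_sumr torus_grid_sum //.
  by rewrite /eqv; case: ifP; rewrite ?mulr0 // mulrC.
have hle : normc (\sum_(a <- J | eqv a) F a) <= eps / 2.
  have Nd0 : 0 < (N%:R : R) ^+ d by rewrite exprn_gt0 // ltr0n.
  rewrite -(ler_pM2l Nd0).
  have -> : (N%:R : R) ^+ d * normc (\sum_(a <- J | eqv a) F a) =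
     normc ((N%:R : C) ^+ d * \sum_(a <- J | eqv a) F a).
    rewrite ComplexField.Normc.normcM normcX; congr (_ ^+ _ * _).
    by rewrite -(rmorph_nat (real_complex R)) normc_real ger0_norm.
  rewrite -hsum; apply: le_trans (ler_normc_sum _ _ _) _.
  apply: (@le_trans _ _ (\sum_(g : {ffun 'I_d -> 'I_N}) (eps / 2))).
    apply: ler_sum => g _; rewrite ComplexField.Normc.normcM normc_prod.
    rewrite big1 => [|j _]; last by rewrite !normcX nw !expr1n.
    by rewrite mul1r ltW // hJg // JgJ.
  by rewrite sumr_const card_ffun !card_ord -[leLHS]mulr_natl natrX.
have split0 : \sum_(a <- J | eqv a) F a =
    F a0 + \sum_(a <- [fset a in J | eqv a && (a != a0)]%fset) F a.
  rewrite -big_fset_condE /= [LHS](bigID (pred1 a0)) /=; congr (_ + _).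
  rewrite big_fset_condE (_ : [fset a in J | _]%fset = [fset a0]%fset).
    by rewrite big_seq_fset1.
  apply/fsetP => a; rewrite !inE /=; case: eqVneq => [->|_]; rewrite ?andbF //.
  by rewrite eqv0 /= ?andbT ?a0J.
have hK : \sum_(a <- [fset a in J | eqv a && (a != a0)]%fset) normc (F a) <= eps / 2.
  apply: hJ0; apply/fdisjointP => a aJ0; rewrite !inE /=.
  case ea: (eqv a); rewrite ?andbF //=.
  by rewrite [a]eqvP ?eqxx ?andbF // !inE aJ0 orbT.
have -> : F a0 = \sum_(a <- J | eqv a) F a -
    \sum_(a <- [fset a in J | eqv a && (a != a0)]%fset) F a.
  by rewrite split0 addrK.
apply: le_trans (le_normcD _ _) _; rewrite normcN [eps]splitr.
by apply: lerD => //; apply: le_trans (ler_normc_sum _ _ _) _.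
Qed.

(** Makes the choice in the definition of [coef] immaterial. *)
Lemma power_series_coef_uniq (f : 'rV[C]_d -> C) (c c' : multi_index d -> C) :
  power_series_at f 0 c -> power_series_at f 0 c' -> c = c'.
Proof.
move=> [e1 e1_gt0 h1] [e2 e2_gt0 h2]; apply/funext => a; apply/eqP.
rewrite -subr_eq0; apply/eqP.
have e0 : 0 < Num.min e1 e2 by rewrite lt_min e1_gt0.
apply: (zero_power_series (b := fun a => c a - c' a) e0) => z hz e e_gt0.
have e2_gt : 0 < e / 2 by rewrite divr_gt0.
have [j|J1 hJ1] := h1 z _ _ e2_gt.
  by rewrite mxE subr0; apply: lt_le_trans (hz j) _; rewrite ge_min lexx.
have [j|J2 hJ2] := h2 z _ _ e2_gt.
  by rewrite mxE subr0; apply: lt_le_trans (hz j) _; rewrite ge_min lexx orbT.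
exists (J1 `|` J2)%fset => J sJ.
have {}hJ1 := hJ1 _ (fsubset_trans (fsubsetUl _ _) sJ).
have {}hJ2 := hJ2 _ (fsubset_trans (fsubsetUr _ _) sJ).
rewrite !lte_fin !subr0 in hJ1 hJ2 *.
have -> : 0 - \sum_(i <- J) (c i - c' i) * monomial z i =
   (f z - \sum_(i <- J) c i * monomial z i)
     - (f z - \sum_(i <- J) c' i * monomial z i).
  under eq_bigr do rewrite mulrBl.
  by rewrite sumrB; ring.
apply: le_lt_trans (le_normcD _ _) _; rewrite normcN [e]splitr.
exact: ltrD.
Qed.

Lemma coefE (f : 'rV[C]_d -> C) (c : multi_index d -> C) :
  power_series_at f 0 c -> coef f = c.
Proof.
move=> h; apply: (@power_series_coef_uniq f) => //.
by rewrite /coef; case: xgetP => [c' -> //|/(_ c)].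
Qed.

Lemma coef_dilate (f : 'rV[C]_d -> C) (r : R) (c : multi_index d -> C) :
  0 < r < 1 -> power_series_at f 0 c ->
  coef (dilate r f) = fun a => real_complex R r ^+ mdeg a * c a.
Proof.
move=> /andP[r0 r1] [e e0 h]; apply: coefE; exists e => // z hz.
move=> d0 d0_gt0; have [|J hJ] := h (real_complex R r *: z) _ d0 d0_gt0.
  move=> j; rewrite !mxE subr0 ComplexField.Normc.normcM normc_real gtr0_norm //.
  have := hz j; rewrite mxE subr0; apply: le_lt_trans.
  by rewrite ler_piMl ?normc_ge0 // ltW.
exists J => J' /hJ; rewrite !subr0 /dilate.
congr ((normc (_ - _))%:E < _)%E; apply: eq_bigr => a _.
by rewrite monomialZ mulrCA mulrA.
Qed.

End Uniqueness.

(** * Operators on a Hilbert space *)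

Section HilbertBasics.
Variables (R : realType) (H : hilbertType R).
Local Notation C := R[i].
Implicit Types (x y : H) (A : {linear H -> H}).

Lemma hnorm_ge0 x : 0 <= hnorm x. Proof. exact: sqrtr_ge0. Qed.

Lemma hnorm_sqrE x : real_complex R (hnorm x ^+ 2) = hdot H x x.
Proof.
have h := dnorm_ge0 (hdot H) x.
move: (h); rewrite lecE /= => /andP[/eqP hi hr].
rewrite sqr_sqrtr //; apply/eqP; rewrite eq_complex /= eqxx /=.
by rewrite hi.
Qed.

Lemma hnormZ (k : C) x : hnorm (k *: x) = normc k * hnorm x.
Proof.
apply/eqP; rewrite -(@eqrXn2 _ 2) ?mulr_ge0 ?hnorm_ge0 ?normc_ge0 //.
rewrite exprMn; apply/eqP; apply: (@complexI R).
rewrite hnorm_sqrE linearZl_LR /= linearZr_LR /= rmorphM rmorphXn /= hnorm_sqrE.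
by rewrite mulrA -normCK normcE_norm.
Qed.

Lemma hnorm0 : hnorm (0 : H) = 0.
Proof. by rewrite -(scale0r 0) hnormZ ComplexField.Normc.normc0 mul0r. Qed.

Lemma hnorm_eq0 x : hnorm x = 0 -> x = 0.
Proof.
move=> h; apply/eqP; rewrite -(dnorm_eq0 (hdot H)) -hnorm_sqrE h.
by rewrite expr0n.
Qed.

Lemma opnorm_le1P A : (opnorm A <= 1)%E -> forall x, hnorm (A x) <= hnorm x.
Proof.
move=> hA x; have [->|x0] := eqVneq x 0; first by rewrite linear0.
have nx0 : 0 < hnorm x.
  rewrite lt_def hnorm_ge0 andbT; apply: contra x0 => /eqP h.
  by apply/eqP; exact: hnorm_eq0.
pose k := real_complex R (hnorm x)^-1.
have nk : normc k = (hnorm x)^-1 by rewrite normc_real gtr0_norm ?invr_gt0.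
have : ((hnorm (A (k *: x)))%:E <= 1)%E.
  apply: le_trans hA; apply: ereal_sup_ubound; exists (k *: x) => //=.
  by rewrite hnormZ nk mulVf // gt_eqF.
by rewrite linearZ /= hnormZ nk lee_fin ler_pdivrMl // mulr1.
Qed.

Lemma opnorm_le (A : H -> H) (k : R) :
  (forall x, hnorm (A x) <= k * hnorm x) -> 0 <= k -> (opnorm A <= k%:E)%E.
Proof.
move=> h k0; apply: ge_ereal_sup => _ [x /= hx <-]; rewrite lee_fin.
by apply: le_trans (h x) _; rewrite ler_piMr.
Qed.

End HilbertBasics.

Section OperatorMonomial.
Variables (R : realType) (H : hilbertType R) (d : nat).
Variable T : 'I_d -> {linear H -> H}.
Implicit Types (a : multi_index d).

Definition add1 a j : multi_index d := [ffun i => (a i + (i == j))%N].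

Lemma op_monomial0 x : op_monomial T [ffun=> 0%N] x = x.
Proof.
rewrite /op_monomial; elim/big_ind: _ => // [f g hf hg|j _].
  by rewrite /= hg.
by rewrite ffunE.
Qed.

Lemma op_monomial_is_linear a : linear (op_monomial T a).
Proof.
rewrite /op_monomial; elim/big_ind: _ => //.
  by move=> f g hf hg k x y /=; rewrite hg hf.
move=> j _ k x y; elim: (a j) => //= n ->; exact: linearP.
Qed.

Hypothesis Tcomm : forall i j x, T i (T j x) = T j (T i x).

(** The factors of [op_monomial] are composed in the order of the variables;
    commutation lets the new factor [T j] move to the front. *)
Lemma op_monomialS a j x : op_monomial T (add1 a j) x = T j (op_monomial T a x).
Proof.
rewrite /op_monomial.
have itC i n y : iter n (T i) (T j y) = T j (iter n (T i) y).
  by elim: n => //= n ->.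
have key (s : seq 'I_d) : uniq s ->
  (\big[comp/id]_(i <- s) iter (add1 a j i) (T i) : H -> H) x =
  if j \in s then T j ((\big[comp/id]_(i <- s) iter (a i) (T i) : H -> H) x)
  else (\big[comp/id]_(i <- s) iter (a i) (T i) : H -> H) x.
  elim: s => [|i s IH] /=; first by rewrite !big_nil.
  case/andP=> iNs us; rewrite !big_cons inE /= ffunE IH //.
  case: (eqVneq j i) iNs => [<- jNs|ij _] /=.
    by rewrite (negbTE jNs) addn1.
  by rewrite addn0; case: ifP => // _; rewrite itC.
by rewrite key ?index_enum_uniq // mem_index_enum.
Qed.

End OperatorMonomial.

(** * Finite-dimensional Hilbert spaces *)

Lemma real_cauchy_lim (R : realType) (a : nat -> R) :
  (forall e : R, 0 < e -> exists n0 : nat, forall m n : nat,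
     (n0 <= m)%N -> (n0 <= n)%N -> `|a m - a n| < e) ->
  exists l : R, forall e : R, 0 < e -> exists n0 : nat, forall n : nat,
     (n0 <= n)%N -> `|a n - l| < e.
Proof.
move=> ha; have : cvgn a.
  apply/cauchy_cvgP; apply: cauchy_exP => e e0.
  have [n0 hn0] := ha e e0; exists (a n0); exists n0 => // n /= n0n.
  exact: hn0.
move=> /cvgrPdist_lt h; exists (limn a) => e e0.
by have [n0 _ hn0] := h e e0; exists n0 => n /hn0; rewrite distrC.
Qed.

Section FiniteDimensional.
Variables (R : realType) (I : finType).
Local Notation C := R[i].
Local Notation V := {ffun I -> C}.

Definition fdot (u v : V) : C := \sum_i u i * (v i)^*.

Lemma fdot_bilinear :
  bilinear_for (GRing.Scale.Law.clone _ _ *%R _)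
    (GRing.Scale.Law.clone _ _ (Num.conj \; *%R) _) fdot.
Proof.
split=> [v|u] k x y; rewrite /fdot /= mulr_sumr -big_split /=; apply: eq_bigr => i _.
  by rewrite !ffunE mulrDl mulrA.
by rewrite !ffunE rmorphD rmorphM mulrDr /= mulrCA.
Qed.

HB.instance Definition _ := bilinear_isBilinear.Build C V V C _ _ fdot fdot_bilinear.

Lemma fdot_hermitian u v : fdot u v = (-1) ^+ false * (fdot v u)^*.
Proof.
rewrite expr0 mul1r /fdot rmorph_sum /=; apply: eq_bigr => i _.
by rewrite rmorphM /= conjCK mulrC.
Qed.

HB.instance Definition _ := isHermitianSesquilinear.Build C V false Num.conj fdot fdot_hermitian.

Lemma fdot_gt0 u : u != 0 -> 0 < fdot u u.
Proof.
move=> u0; have ge0 i : 0 <= u i * (u i)^* by rewrite -normCK exprn_ge0.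
rewrite lt_def sumr_ge0 // andbT; apply: contra u0 => /eqP h.
apply/eqP/ffunP => i; rewrite ffunE; apply/eqP.
rewrite -normr_eq0 -sqrf_eq0 normCK; apply/eqP.
exact: (psumr_eq0P (fun i _ => ge0 i) h).
Qed.

HB.instance Definition _ := isDotProduct.Build C V fdot fdot_gt0.

Definition fdot_form : {dot V for Num.conj} := fdot.

Lemma fdot_norm_sqr (u : V) : dot_norm fdot_form u ^+ 2 = \sum_i normc (u i) ^+ 2.
Proof.
have h : fdot u u = real_complex R (\sum_i normc (u i) ^+ 2).
  by rewrite rmorph_sum; apply: eq_bigr => i _; rewrite -normCK normcE_norm rmorphXn.
rewrite /dot_norm /= h /= sqr_sqrtr //.
by apply: sumr_ge0 => i _; rewrite exprn_ge0 ?normc_ge0.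
Qed.

Lemma fdot_norm_ge0 (u : V) : 0 <= dot_norm fdot_form u.
Proof. exact: sqrtr_ge0. Qed.

Lemma fdot_norm_le (u : V) (e : R) : 0 <= e ->
  (forall i, normc (u i) <= e) -> dot_norm fdot_form u <= (#|I|%:R + 1) * e.
Proof.
move=> e0 h; rewrite -(@ler_pXn2r _ 2) // ?nnegrE ?fdot_norm_ge0 //; last first.
  by rewrite mulr_ge0 // addr_ge0.
rewrite fdot_norm_sqr exprMn; apply: (@le_trans _ _ (\sum_(i : I) e ^+ 2)).
  by apply: ler_sum => i _; rewrite ler_pXn2r ?nnegrE ?normc_ge0.
rewrite sumr_const -[leLHS]mulr_natl; apply: ler_wpM2r; first exact: exprn_ge0.
by have N0 := ler0n R #|I|; nra.
Qed.

Lemma ler_coord_norm (u : V) i : normc (u i) <= dot_norm fdot_form u.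
Proof.
rewrite -(@ler_pXn2r _ 2) // ?nnegrE ?normc_ge0 ?fdot_norm_ge0 //.
rewrite fdot_norm_sqr (bigD1 i) //= lerDl.
by apply: sumr_ge0 => j _; rewrite exprn_ge0 ?normc_ge0.
Qed.

Lemma fdot_complete : dot_complete fdot_form.
Proof.
move=> u hu.
have coordP (g : C -> R) : (forall x y, g (x - y) = g x - g y) ->
    (forall x, `|g x| <= normc x) -> forall i, exists l : R,
    forall e : R, 0 < e -> exists n0 : nat, forall n : nat,
    (n0 <= n)%N -> `|g (u n i) - l| < e.
  move=> gB gle i; apply: real_cauchy_lim => e e0.
  have [n0 hn0] := hu e e0; exists n0 => m n hm hn.
  apply: le_lt_trans (hn0 m n hm hn); rewrite -gB.
  by apply: le_trans (gle _) _; have := ler_coord_norm (u m - u n) i; rewrite !ffunE.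
have /choice [lre hre] := coordP (@complex.Re R) ltac:(by move=> [? ?] [? ?]) (@ler_normc_Re R).
have /choice [lim him] := coordP (@complex.Im R) ltac:(by move=> [? ?] [? ?]) (@ler_normc_Im R).
pose x : V := [ffun i => (lre i +i* lim i)%C].
exists x => e e0; pose k : R := #|I|%:R + 1.
have k0 : 0 < k by rewrite ltr_wpDl.
(* The crude bound [k] on the norm in terms of the coordinates suffices. *)
have e4 : 0 < e / k / 4 by rewrite !divr_gt0.
have /choice [nre hnre] := fun i => hre i _ e4.
have /choice [nim hnim] := fun i => him i _ e4.
exists (\max_(i : I) maxn (nre i) (nim i)) => n hn.
apply: (@le_lt_trans _ _ (k * (e / k / 2))); last first.
  have -> : k * (e / k / 2) = e / 2 by field; rewrite gt_eqF.
  by lra.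
apply: fdot_norm_le => [|i]; first by rewrite !divr_ge0 // ltW.
have hi : (maxn (nre i) (nim i) <= n)%N by apply: leq_trans hn; exact: leq_bigmax.
have h1 := hnre i n (leq_trans (leq_maxl _ _) hi).
have h2 := hnim i n (leq_trans (leq_maxr _ _) hi).
apply: le_trans (ler_normc_ReIm _) _; rewrite !ffunE.
move: h1 h2; case: (u n i) => a b /= h1 h2.
by apply: le_trans (ltW (ltrD h1 h2)) _; lra.
Qed.

Definition l2space : hilbertType R := Hilbert fdot_complete.

Lemma hnorm_l2_sqr (u : l2space) :
  hnorm u ^+ 2 = \sum_i normc ((u : V) i) ^+ 2.
Proof. exact: fdot_norm_sqr. Qed.

End FiniteDimensional.

(** * Multi-indices *)

Section MultiIndexInduction.
Variable d : nat.
Implicit Types a : multi_index d.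

Lemma mdeg0 : mdeg ([ffun=> 0%N] : multi_index d) = 0%N.
Proof. by rewrite /mdeg big1 // => j _; rewrite ffunE. Qed.

Lemma mdeg_add1 a j : mdeg (add1 a j) = (mdeg a).+1.
Proof.
rewrite /mdeg; under eq_bigr do rewrite ffunE.
rewrite big_split /= -[RHS]addn1; congr addn.
by rewrite (bigD1 j) //= eqxx big1 // => i /negbTE ->.
Qed.

Lemma add1C a i j : add1 (add1 a i) j = add1 (add1 a j) i.
Proof. by apply/ffunP => k; rewrite !ffunE addnAC. Qed.

Lemma add1_inj j : injective (fun a => add1 a j).
Proof. by move=> a b /ffunP h; apply/ffunP => k; have := h k; rewrite !ffunE => /addIn. Qed.

(** Induction on the total degree, one variable at a time; it matches
    [op_monomialS]. *)
Lemma multi_index_ind (P : multi_index d -> Prop) :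
  P [ffun=> 0%N] -> (forall a j, P a -> P (add1 a j)) -> forall a, P a.
Proof.
move=> P0 PS a; have [n] := ubnP (mdeg a); elim: n a => // n IH a hn.
case: (pickP (fun j => 0 < a j)%N) => [j aj|a0].
  pose b : multi_index d := [ffun i => (a i - (i == j))%N].
  have ab : a = add1 b j.
    apply/ffunP => i; rewrite !ffunE subnK //.
    by case: eqVneq => [->|].
  rewrite ab; apply/PS/IH; move: hn; rewrite ab mdeg_add1.
  by rewrite ltnS.
have -> : a = [ffun=> 0%N]; last exact: P0.
by apply/ffunP => j; rewrite ffunE; apply/eqP; rewrite eqn0Ngt a0.
Qed.

(** Multi-indices with entries below [M] form a finite type, so that sums over
    all multi-indices of a given degree become finite sums. *)
Definition mindex M (b : {ffun 'I_d -> 'I_M}) : multi_index d :=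
  [ffun j => val (b j)].

Lemma mindex_inj M : injective (@mindex M).
Proof.
move=> b c /ffunP h; apply/ffunP => j; apply/val_inj.
by have := h j; rewrite !ffunE.
Qed.

Lemma mindex_lift M a : (mdeg a < M)%N -> exists b : {ffun 'I_d -> 'I_M}, mindex b = a.
Proof.
case: M => // M aM; exists [ffun j => inord (a j)].
apply/ffunP => j; rewrite !ffunE /= inordK //.
by apply: leq_ltn_trans aM; exact: leq_mdeg.
Qed.

End MultiIndexInduction.

(** * The test tuple *)

(** Cauchy-Schwarz against a constant vector, with the number of terms replaced
    by any upper bound [K ^+ 2]. *)
Lemma sqr_sum_le (R : realFieldType) (I : finType) (P : pred I) (x : I -> R) (K : R) :
  0 < K -> #|P|%:R <= K ^+ 2 ->
  (\sum_(i | P i) x i) ^+ 2 <= K ^+ 2 * \sum_(i | P i) x i ^+ 2.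
Proof.
move=> K0 hN; set S := \sum_(i | P i) x i; set Q := \sum_(i | P i) _.
have : 0 <= \sum_(i | P i) (K ^+ 2 * x i - S) ^+ 2.
  by apply: sumr_ge0 => i _; exact: sqr_ge0.
have -> : \sum_(i | P i) (K ^+ 2 * x i - S) ^+ 2 =
    K ^+ 4 * Q - 2 * K ^+ 2 * S * S + #|P|%:R * S ^+ 2.
  rewrite (_ : K ^+ 4 * Q = \sum_(i | P i) K ^+ 4 * x i ^+ 2) ?mulr_sumr //.
  rewrite [X in _ - X + _](_ : _ = \sum_(i | P i) 2 * K ^+ 2 * S * x i).
    rewrite (_ : #|P|%:R * S ^+ 2 = \sum_(i | P i) S ^+ 2).
      by rewrite -sumrB -big_split /=; apply: eq_bigr => i _; ring.
    by rewrite mulr_natl -sumr_const; apply: eq_bigl.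
  by apply: eq_bigr => i _; rewrite -mulr_sumr.
have K2 : 0 < K ^+ 2 by rewrite exprn_gt0.
have hS : #|P|%:R * S ^+ 2 <= K ^+ 2 * S ^+ 2 by rewrite ler_wpM2r // sqr_ge0.
move=> h; rewrite -(ler_pM2l K2); nra.
Qed.

Lemma big_option (V : nmodType) (B : finType) (F : option B -> V) :
  \sum_(o : option B) F o = F None + \sum_(b : B) F (Some b).
Proof.
rewrite (bigD1 None) //=; congr (_ + _).
rewrite (reindex_omap Some id) => [|[b|]] //=.
by apply: eq_bigl => b; rewrite eqxx.
Qed.

(** A partial injection of the index set does not increase the l2 norm. *)
Lemma sum_normc_sqr_inj (R : realType) (I J : finType) (P : I -> J -> bool)
    (Q : pred I) (v : I -> R[i]) :
  (forall i i' j, P i j -> P i' j -> i = i') ->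
  (forall i j j', P i j -> P i j' -> j = j') ->
  (forall i j, P i j -> Q i) ->
  \sum_j normc (\sum_(i | P i j) v i) ^+ 2 <= \sum_(i | Q i) normc (v i) ^+ 2.
Proof.
move=> injl injr PQ.
have -> : \sum_j normc (\sum_(i | P i j) v i) ^+ 2
    = \sum_j \sum_(i | P i j) normc (v i) ^+ 2.
  apply: eq_bigr => j _; case: (pickP (P^~ j)) => [i Pij|P0].
    by rewrite !(big_pred1 i) // => i'; apply/idP/eqP => [h|->//]; exact: injl h Pij.
  by rewrite !big_pred0 // ComplexField.Normc.normc0 expr0n.
rewrite (exchange_big_dep Q) /= => [|j i _ /PQ //]; apply: ler_sum => i _.
case: (pickP (P i)) => [j Pij|P0].
  by rewrite (big_pred1 j) // => j'; apply/idP/eqP => [h|->//]; exact: injr h Pij.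
by rewrite big_pred0 // exprn_ge0 ?normc_ge0.
Qed.

Section TestTuple.
Variables (R : realType) (d m : nat).
Local Notation C := R[i].
Local Notation B := {ffun 'I_d -> 'I_m.+2}.
Local Notation H := (l2space R (option B)).
Local Notation V := {ffun option B -> C}.
Variables (sigma : multi_index d -> C) (K rho : R).
Hypothesis sigma1 : forall a, normc (sigma a) <= 1.
Hypothesis K_gt0 : 0 < K.
Hypothesis cardK : #|[pred b : B | mdeg (mindex b) == m]|%:R <= K ^+ 2.
Hypothesis rho01 : 0 <= rho < 1.
Local Notation cR := (real_complex R).

(** The vectors [test_basis a] are orthonormal for [mdeg a <= m], where the
    tuple acts as the commutative multishift. All degrees [m.+1] are collapsed
    onto one unit vector [test_top], with weight [sigma a / K], and higher
    degrees vanish. With this convention [T_j] sends [test_basis a] to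
    [rho *: test_basis (a + e_j)] for every [a], which makes commutation and
    the computation of monomials immediate. *)
Definition test_basis (a : multi_index d) : V :=
  [ffun o => if o is Some b then ((mdeg a <= m)%N && (mindex b == a))%:R
             else if mdeg a == m.+1 then sigma a / cR K else 0].

Definition test_top : V := [ffun o => (o == None)%:R].

Definition test_op (j : 'I_d) (v : V) : V :=
  cR rho *: \sum_(b : B | (mdeg (mindex b) <= m)%N)
    v (Some b) *: test_basis (add1 (mindex b) j).

Lemma test_op_linear j : linear (test_op j : H -> H).
Proof.
move=> k u v; rewrite /test_op scalerA mulrC -scalerA -scalerDr; congr (_ *: _).
rewrite scaler_sumr -big_split /=; apply: eq_bigr => b _.
by rewrite !ffunE scalerDl scalerA.
Qed.

HB.instance Definition _ j := GRing.isLinear.Build C H H _ (test_op j : H -> H) (test_op_linear j).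

Definition test_tuple (j : 'I_d) : {linear H -> H} := (test_op j : H -> H).

Lemma test_op_basis j a : test_op j (test_basis a) = cR rho *: test_basis (add1 a j).
Proof.
congr (_ *: _); case: (leqP (mdeg a) m) => am.
  have [|b0 hb0] := @mindex_lift d m.+2 a; first by rewrite ltnS leqW.
  rewrite (bigD1 b0) /= ?hb0 // ffunE am hb0 eqxx scale1r big1 ?addr0 // => b /andP[_ bb0].
  rewrite ffunE am /= -hb0 (inj_eq (@mindex_inj _ _)) (negbTE bb0); exact: scale0r.
rewrite big1 => [|b _]; last first.
  by rewrite ffunE leqNgt am /= scale0r.
apply/ffunP => -[b|]; rewrite !ffunE mdeg_add1.
  by rewrite leqNgt ltnS ltnW.
by rewrite eqSS gtn_eqF.
Qed.

Lemma test_op_top j : test_op j test_top = 0.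
Proof.
rewrite /test_op big1 ?scaler0 // => b _.
by rewrite ffunE /= scale0r.
Qed.

Lemma test_op_comm i j (x : V) :
  test_op i (test_op j x) = test_op j (test_op i x).
Proof.
have h i' j' : test_op i' (test_op j' x) = cR rho *: (cR rho *:
    \sum_(b : B | (mdeg (mindex b) <= m)%N) x (Some b) *:
       test_basis (add1 (add1 (mindex b) j') i')).
  rewrite [test_op j' x]/test_op -[test_op i']/(test_tuple i' : V -> V) linearZ linear_sum /=.
  congr (_ *: _); rewrite scaler_sumr; apply: eq_bigr => b _.
  rewrite linearZ /= test_op_basis !scalerA; congr (_ *: _); exact: mulrC.
rewrite (h i j) (h j i).
by under [in LHS]eq_bigr do rewrite add1C.
Qed.

Lemma test_tuple_comm i j (x : H) :
  test_tuple i (test_tuple j x) = test_tuple j (test_tuple i x).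
Proof. exact: test_op_comm. Qed.

Lemma test_op_some j v b :
  test_op j v (Some b) = cR rho *
    \sum_(c : B | (mdeg (mindex c) < m)%N && (mindex b == add1 (mindex c) j)) v (Some c).
Proof.
rewrite ffunE /=; congr (_ * _); rewrite sum_ffunE.
rewrite [RHS]big_mkcond [LHS]big_mkcond /=; apply: eq_bigr => c _.
rewrite !ffunE mdeg_add1; case: (leqP (mdeg (mindex c)) m) => cm.
  by case: ifP => _; [exact: mulr1|exact: mulr0].
by rewrite ltnNge (ltnW cm).
Qed.

Lemma test_op_none j v :
  test_op j v None = cR rho *
    \sum_(c : B | mdeg (mindex c) == m) v (Some c) * (sigma (add1 (mindex c) j) / cR K).
Proof.
rewrite ffunE /=; congr (_ * _); rewrite sum_ffunE.
rewrite [RHS]big_mkcond [LHS]big_mkcond /=; apply: eq_bigr => c _.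
rewrite !ffunE mdeg_add1 eqSS; case: (ltngtP (mdeg (mindex c)) m) => cm //.
exact: mulr0.
Qed.

(** On degrees below [m] the operator is [rho] times a partial isometry; on
    degree [m] it is a functional with values in the line of [test_top], of
    norm at most [rho] by Cauchy-Schwarz because there are at most [K ^+ 2]
    indices of degree [m]. The two images are orthogonal. *)
Lemma test_op_le j (v : H) : hnorm (test_tuple j v) <= rho * hnorm v.
Proof.
have /andP[rho0 _] := rho01.
rewrite -(@ler_pXn2r _ 2) // ?nnegrE ?mulr_ge0 ?hnorm_ge0 //.
rewrite exprMn !hnorm_l2_sqr !big_option /=.
have nrho : normc (cR rho) = rho by rewrite normc_real ger0_norm.
rewrite test_op_none; under [X in _ + X]eq_bigr do rewrite test_op_some.
rewrite ComplexField.Normc.normcM nrho exprMn.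
under eq_bigr do rewrite ComplexField.Normc.normcM nrho exprMn.
rewrite -mulr_sumr -mulrDr; apply: ler_wpM2l; first exact: sqr_ge0.
have hnone : normc (\sum_(c : B | mdeg (mindex c) == m)
     (v : V) (Some c) * (sigma (add1 (mindex c) j) / cR K)) ^+ 2
   <= \sum_(c : B | mdeg (mindex c) == m) normc ((v : V) (Some c)) ^+ 2.
  set Q := leRHS; have K2 : 0 < K ^+ 2 by rewrite exprn_gt0.
  rewrite -(ler_pM2l K2) -exprMn.
  apply: le_trans (sqr_sum_le (fun c => normc ((v : V) (Some c))) K_gt0 cardK).
  rewrite ler_pXn2r ?nnegrE ?mulr_ge0 ?sumr_ge0 ?normc_ge0 // ?(ltW K_gt0) //; last first.
    by move=> *; exact: normc_ge0.
  rewrite -[K in K * _](ger0_norm (ltW K_gt0)) -normc_real.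
  rewrite -ComplexField.Normc.normcM mulr_sumr.
  apply: le_trans (ler_normc_sum _ _ _) _; apply: ler_sum => c _.
  have cK0 : cR K != 0 by rewrite fmorph_eq0 gt_eqF.
  have -> : cR K * ((v : V) (Some c) * (sigma (add1 (mindex c) j) / cR K))
      = sigma (add1 (mindex c) j) * (v : V) (Some c) by field.
  by rewrite ComplexField.Normc.normcM ler_piMl ?normc_ge0.
apply: le_trans (lerD hnone _) _.
  apply: (@sum_normc_sqr_inj _ _ _ _ (fun c : B => (mdeg (mindex c) < m)%N)).
  - move=> c c' b /andP[_ /eqP ->] /andP[_ /eqP /add1_inj].
    by move/mindex_inj.
  - by move=> c b b' /andP[_ /eqP h] /andP[_ /eqP h']; apply/mindex_inj; rewrite h h'.
  - by move=> c b /andP[].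
apply: (@le_trans _ _ (\sum_(c : B) normc ((v : V) (Some c)) ^+ 2)); last first.
  by rewrite lerDr exprn_ge0 ?normc_ge0.
rewrite [leRHS](bigID (fun c => mdeg (mindex c) == m)) /= lerD2l.
rewrite [leLHS]big_mkcond [leRHS]big_mkcond /=; apply: ler_sum => c _.
case: ltngtP => //= _; by rewrite exprn_ge0 ?normc_ge0.
Qed.

Lemma test_tuple_monomial_basis a :
  op_monomial test_tuple a (test_basis [ffun=> 0%N]) = cR rho ^+ mdeg a *: test_basis a.
Proof.
elim/multi_index_ind: a => [|a j IH].
  by rewrite op_monomial0 mdeg0 expr0 scale1r.
rewrite op_monomialS; last exact: test_tuple_comm.
by rewrite IH linearZ /= test_op_basis scalerA mdeg_add1 exprSr.
Qed.

Lemma test_tuple_monomial_top a :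
  op_monomial test_tuple a test_top = (a == [ffun=> 0%N])%:R *: test_top.
Proof.
elim/multi_index_ind: a => [|a j IH].
  by rewrite op_monomial0 eqxx scale1r.
rewrite op_monomialS; last exact: test_tuple_comm.
rewrite IH linearZ /= test_op_top scaler0.
case: eqP => [/ffunP /(_ j)|_]; last by rewrite scale0r.
by rewrite !ffunE eqxx addn1.
Qed.

Lemma test_basis_large a : (m.+1 < mdeg a)%N -> test_basis a = 0.
Proof.
move=> h; apply/ffunP => -[b|]; rewrite !ffunE.
  by rewrite leqNgt (leq_ltn_trans _ h).
by rewrite gtn_eqF.
Qed.

End TestTuple.

(** * Coefficients of functions in the Agler class *)

(** On a vector killed by all but finitely many terms the operator-norm limit
    is a finite sum. *)
Lemma op_eval_finite (R : realType) (H : hilbertType R) d (f : 'rV[R[i]]_d -> R[i])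
    (T : 'I_d -> {linear H -> H}) (A : {linear H -> H})
    (D : {fset multi_index d}) (x : H) :
  op_eval f T A -> hnorm x <= 1 ->
  (forall a, a \notin D -> coef f a *: op_monomial T a x = 0) ->
  A x = \sum_(a <- D) coef f a *: op_monomial T a x.
Proof.
move=> hA x1 hD; apply/eqP; rewrite -subr_eq0; apply/eqP; apply: hnorm_eq0.
apply/eqP; rewrite eq_le hnorm_ge0 andbT; apply/ler_addgt0Pr => e e0.
have [J0 hJ0] := hA _ e0; rewrite add0r -lee_fin; apply: ltW.
apply: le_lt_trans (hJ0 _ (fsubsetUl _ D)).
apply: ereal_sup_ubound; exists x => //=; congr ((hnorm _)%:E).
rewrite [LHS]/GRing.add /=; congr (_ - _); rewrite fct_sumE.
rewrite [RHS](big_fset_incl _ (fsubsetUr J0 D)) // => a _; exact: hD.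
Qed.

Lemma bernoulli_ge (R : realFieldType) (x : R) n : 0 < x -> x <= 1 ->
  1 - n%:R * x <= (1 - x) ^+ n.
Proof.
move=> x0 x1; elim: n => [|n IH]; first by rewrite mul0r subr0 expr0.
rewrite exprS; apply: (@le_trans _ _ ((1 - x) * (1 - n%:R * x))); last first.
  by rewrite ler_wpM2l // subr_ge0.
rewrite -natr1; have := ler0n R n; nra.
Qed.

Section CoefficientBound.
Variables (R : realType) (d m : nat).
Local Notation C := R[i].
Local Notation B := {ffun 'I_d -> 'I_m.+2}.
Local Notation cR := (real_complex R).
Variables (f : 'rV[C]_d -> C) (K : R).
Hypothesis fA : agler_class f.
Hypothesis K_gt0 : 0 < K.
Hypothesis cardK : #|[pred b : B | mdeg (mindex b) == m]|%:R <= K ^+ 2.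

Let c := coef f.
Let c0 := c [ffun=> 0%N].
Let S := \sum_(b : B | mdeg (mindex b) == m.+1) normc (c (mindex b)).

(** With [sigma] the phases conjugate to those of the coefficients, [A = f(T)]
    has matrix [c0 0; s c0] when compressed to the span of [E0] and [y], where
    [s = rho ^+ m.+1 * S / K]. A contraction of this shape has
    [s + |c0|^2 <= 1]: apply it to [E0 + t y] with [t] the conjugate of [c0]. *)
Lemma coef_bound_scaled (rho : R) : 0 <= rho < 1 ->
  rho ^+ m.+1 * S / K <= 1 - normc c0 ^+ 2.
Proof.
move=> rho01; have /andP[rho0 rho1] := rho01.
pose sigma a := if c a == 0 then 0 else cR (normc (c a)) / c a.
have sigmaE a : sigma a * c a = cR (normc (c a)).
  rewrite /sigma; case: eqVneq => [->|ca]; last by rewrite divfK.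
  by rewrite mulr0 ComplexField.Normc.normc0.
have sigma1 a : normc (sigma a) <= 1.
  rewrite /sigma; case: eqVneq => [_|ca]; first by rewrite ComplexField.Normc.normc0.
  rewrite ComplexField.Normc.normcM normc_real ger0_norm ?normc_ge0 //.
  rewrite ComplexField.Normc.normcV divff //.
  by apply: contra ca => /eqP/ComplexField.Normc.eq0_normc ->.
pose H := l2space R (option B).
pose T := test_tuple m sigma K rho : 'I_d -> {linear H -> H}.
pose E0 : H := test_basis m sigma K [ffun=> 0%N].
pose y : H := test_top R d m.
have [|b0 hb0] := @mindex_lift d m.+2 [ffun=> 0%N]; first by rewrite mdeg0.
have sqE t : hnorm (E0 + t *: y) ^+ 2 = 1 + normc t ^+ 2.
  rewrite hnorm_l2_sqr big_option addrC (bigD1 b0) //= big1 => [|b /negbTE bb0].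
    rewrite !ffunE mdeg0 /= -hb0 eqxx /=.
    by rewrite [t *: 0]mulr0 [t *: 1]mulr1 !addr0 add0r ComplexField.Normc.normc1 expr1n.
  rewrite !ffunE mdeg0 /= -hb0 (inj_eq (@mindex_inj _ _)) bb0 scaler0 addr0.
  by rewrite ComplexField.Normc.normc0 expr0n.
have nE0 : hnorm E0 <= 1.
  by rewrite -(@ler_pXn2r _ 2) // ?nnegrE ?hnorm_ge0 // -[E0]addr0 -(scale0r y) sqE
   ComplexField.Normc.normc0 expr0n addr0 expr1n.
have ny : hnorm y <= 1.
  rewrite -(@ler_pXn2r _ 2) // ?nnegrE ?hnorm_ge0 // hnorm_l2_sqr big_option.
  rewrite big1 => [|b _]; rewrite ffunE /=.
    by rewrite !expr0n !expr1n /= !addr0 sqrtr1 expr1n.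
  by rewrite !expr0n /= addr0 sqrtr0 expr0n.
have [|j|A hA A1] := fA.2 H T.
- exact: test_tuple_comm.
- apply: le_lt_trans (opnorm_le _ rho0) _ => //.
  exact: test_op_le.
pose D : {fset multi_index d} := [fset @mindex d m.+2 b | b in predT]%fset.
have DP a : a \notin D -> (m.+1 < mdeg a)%N.
  rewrite ltnNge; apply: contra => am; have [b <-] := @mindex_lift d m.+2 a am.
  by apply/imfsetP; exists b.
have AE0 : A E0 = \sum_(b : B) c (mindex b) *:
    (cR rho ^+ mdeg (mindex b) *: test_basis m sigma K (mindex b) : H).
  rewrite (op_eval_finite (D := D) hA nE0) => [|a aD]; last first.
    by rewrite test_tuple_monomial_basis // test_basis_large ?DP // !scaler0.
  rewrite big_imfset /= => [|b b' _ _]; last exact: mindex_inj.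
  rewrite big_enum /=; apply: eq_bigr => b _.
  by rewrite test_tuple_monomial_basis.
have Ay : A y = c0 *: y.
  rewrite (op_eval_finite (D := [fset [ffun=> 0%N]]%fset) hA ny) => [|a]; last first.
    by rewrite inE test_tuple_monomial_top => /negbTE ->; rewrite scale0r scaler0.
  by rewrite big_seq_fset1 test_tuple_monomial_top eqxx scale1r.
pose s := rho ^+ m.+1 * S / K.
have s_ge0 : 0 <= s.
  by rewrite /s !mulr_ge0 ?exprn_ge0 ?sumr_ge0 ?invr_ge0 ?(ltW K_gt0) // => b _; exact: normc_ge0.
have AE0s : (A E0 : {ffun _ -> _}) (Some b0) = c0.
  rewrite AE0 sum_ffunE (bigD1 b0) //= big1 => [|b bb0]; rewrite !ffunE /= !hb0.
    by rewrite mdeg0 eqxx /= expr0 addr0 [1 *: _]mulr1 [_ *: _]mulr1.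
  rewrite -hb0 (inj_eq (@mindex_inj _ _)) eq_sym (negbTE bb0) andbF.
  by rewrite [X in _ *: X]mulr0; exact: mulr0.
have AE0n : (A E0 : {ffun _ -> _}) None = cR s.
  rewrite AE0 sum_ffunE /s /S mulr_sumr mulr_suml rmorph_sum /= [RHS]big_mkcond.
  apply: eq_bigr => b _; rewrite !ffunE; case: eqP => [->|_]; last first.
    by rewrite [X in _ *: X]mulr0; exact: mulr0.
  rewrite !rmorphM rmorphXn /= fmorphV -sigmaE.
  by rewrite -[LHS]/(_ * (_ * _)); ring.
pose t := c0^*.
have hA' : A (E0 + t *: y) = A E0 + t *: (c0 *: y) by rewrite linearD linearZ Ay.
have := opnorm_le1P A1 (E0 + t *: y).
rewrite -(@ler_pXn2r _ 2) // ?nnegrE ?hnorm_ge0 // sqE hA' hnorm_l2_sqr big_option.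
rewrite (bigD1 b0) //=.
have -> : ((A E0 + t *: (c0 *: y) : H) : {ffun _ -> _}) (Some b0) = c0.
  by rewrite ffunE AE0s !ffunE /= [c0 *: 0]mulr0 [t *: 0]mulr0 addr0.
have nc0 : normc t = normc c0.
  by apply: (@complexI R); rewrite -!normcE_norm norm_conjC.
have -> : ((A E0 + t *: (c0 *: y) : H) : {ffun _ -> _}) None = cR (s + normc c0 ^+ 2).
  rewrite ffunE AE0n !ffunE /= [c0 *: 1]mulr1 [t *: _]mulrC -normCK normcE_norm.
  by rewrite rmorphD rmorphXn.
rewrite nc0 normc_real => h; rewrite -/s lerBrDr.
have p0 : 0 <= s + normc c0 ^+ 2 by rewrite addr_ge0 // exprn_ge0 ?normc_ge0.
rewrite -(@ler_pXn2r _ 2) // ?nnegrE // expr1n.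
move: h; rewrite ger0_norm // addrA [1 + _]addrC; set X := \sum_(i | _) _.
have X0 : 0 <= X by apply: sumr_ge0 => b _; rewrite exprn_ge0 ?normc_ge0.
lra.
Qed.

(** The case [m = 0], [K = 1] is the Wiener-type bound for the linear
    coefficients. Letting [rho] tend to 1 removes the scaling that the strict
    contractions in the definition of the Agler class impose. *)
Lemma coef_bound : S <= K * (1 - normc c0 ^+ 2).
Proof.
have S0 : 0 <= S by apply: sumr_ge0 => b _; exact: normc_ge0.
apply/ler_addgt0Pr => e e0.
pose k := (m.+1%:R : R) * S + 1.
have k0 : 0 < k by rewrite ltr_wpDl // mulr_ge0.
(* By Bernoulli, [rho = 1 - eta] loses at most [m.+1 * eta * S <= e]. *)
pose eta := Num.min 1 (e / k).
have eta0 : 0 < eta by rewrite lt_min ltr01 divr_gt0.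
have eta1 : eta <= 1 by rewrite ge_min lexx.
have etae : eta * k <= e by rewrite -ler_pdivlMr // ge_min lexx orbT.
have rho01 : 0 <= 1 - eta < 1 by apply/andP; split; lra.
have := coef_bound_scaled rho01; rewrite ler_pdivrMr // mulrC [X in _ <= X]mulrC.
have hB : 1 - m.+1%:R * eta <= (1 - eta) ^+ m.+1.
  exact: bernoulli_ge.
have := ler_wpM2l S0 hB; rewrite /k in etae; nra.
Qed.
End CoefficientBound.

(** * The lower bound for the radius *)

Lemma ler_sum_fset (R : numDomainType) (I : choiceType) (A B : {fset I}) (g : I -> R) :
  (A `<=` B)%fset -> (forall i, 0 <= g i) -> \sum_(i <- A) g i <= \sum_(i <- B) g i.
Proof.
move=> sAB g0; rewrite [leRHS](big_fsetID _ (mem A)) /=.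
rewrite (_ : [fset x in B | x \in A]%fset = A) ?lerDl ?sumr_ge0 //.
apply/fsetP => x; rewrite !inE /=; apply/andP/idP => [[]//|xA].
by split=> //; exact: (fsubsetP sAB).
Qed.

Lemma geometric_sum_le (R : realFieldType) (s : R) n : 0 <= s -> s < 1 ->
  \sum_(i < n) s ^+ i <= (1 - s)^-1.
Proof.
move=> s0 s1; have h : 0 < 1 - s by rewrite subr_gt0.
rewrite -[leRHS]mul1r ler_pdivlMr // mulrC -opprB mulNr -subrX1 opprB.
by rewrite gerBl exprn_ge0.
Qed.

(** Rankin's trick: the generating function of the number of multi-indices by
    degree is at most [(1 - s)^-d], so each of its terms is. *)
Lemma card_mdeg_le (R : realFieldType) (d m M : nat) (s : R) : 0 <= s -> s < 1 ->
  #|[pred b : {ffun 'I_d -> 'I_M} | mdeg (mindex b) == m]|%:R * s ^+ m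
    <= (1 - s)^-1 ^+ d.
Proof.
move=> s0 s1; apply: (@le_trans _ _ (\sum_(b : {ffun 'I_d -> 'I_M}) \prod_(j < d) s ^+ b j)).
  rewrite mulr_natl -sumr_const [leRHS](bigID (fun b => mdeg (mindex b) == m)) /=.
  rewrite -[leLHS]addr0; apply: lerD; last first.
    by apply: sumr_ge0 => b _; apply: prodr_ge0 => j _; exact: exprn_ge0.
  rewrite le_eqVlt; apply/orP; left; apply/eqP; apply: eq_bigr => b.
  rewrite inE => /eqP <-; rewrite /mdeg prodrXr; congr (_ ^+ _).
  by apply: eq_bigr => j _; rewrite ffunE.
rewrite -(bigA_distr_bigA (fun (j : 'I_d) (i : 'I_M) => s ^+ i)) /=.
rewrite prodr_const card_ord lerXn2r ?nnegrE //.
- by apply: sumr_ge0 => i _; exact: exprn_ge0.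
- by rewrite invr_ge0 subr_ge0 ltW.
- exact: geometric_sum_le.
Qed.

Section BohrSufficient.
Variables (R : realType) (d : nat).
Local Notation C := R[i].
Variables (r s : R).
Hypothesis r_gt0 : 0 < r.
Hypothesis r_lt1 : r < 1.
Hypothesis s01 : 0 < s < 1.
Let p := Num.sqrt s.
Let kd := Num.sqrt ((1 - s)^-1 ^+ d).
Hypothesis rp : r < p.
Hypothesis half : r * kd / (1 - r / p) <= 2^-1.

(** By [coef_bound] and [card_mdeg_le], degree [i.+1] contributes at most
    [r * kd * (r / p) ^+ i * (1 - c0 ^+ 2)]. The geometric series gives
    [c0 + (1 - c0 ^+ 2) / 2 <= 1]. *)
Lemma agler_bohr_bound (f : 'rV[C]_d -> C) : agler_class f ->
  (norm1 (dilate r f) <= 1)%E.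
Proof.
move=> fA; have /andP[s0 s1] := s01.
have p0 : 0 < p by rewrite sqrtr_gt0.
have q0 : 0 < (1 - s)^-1 ^+ d by rewrite exprn_gt0 // invr_gt0 subr_gt0.
have kd0 : 0 < kd by rewrite sqrtr_gt0.
have pd0 : polydisk (0 : 'rV[C]_d).
  by move=> j; rewrite mxE ComplexField.Normc.normc0.
have [c hc] := fA.1.1 0 pd0; have cE := coefE hc.
set c0 := normc (c [ffun=> 0%N]).
have hS m (D : {fset multi_index d}) :
    \sum_(a <- D | mdeg a == m.+1) normc (c a) <= kd / p ^+ m * (1 - c0 ^+ 2).
  apply: (@le_trans _ _ (\sum_(b : {ffun 'I_d -> 'I_m.+2} | mdeg (mindex b) == m.+1)
      normc (c (mindex b)))); last first.
    rewrite /c0 -cE; apply: coef_bound => //.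
      by rewrite divr_gt0 // exprn_gt0.
    rewrite expr_div_n -exprM mulnC exprM !sqr_sqrtr ?(ltW s0) ?(ltW q0) //.
    by rewrite ler_pdivlMr ?exprn_gt0 // card_mdeg_le // ltW.
  rewrite big_fset_condE.
  pose D' : {fset multi_index d} :=
    [fset @mindex d m.+2 b | b in [pred b | mdeg (mindex b) == m.+1]]%fset.
  apply: (@le_trans _ _ (\sum_(a <- D') normc (c a))).
    apply: ler_sum_fset => [|a]; last exact: normc_ge0.
    apply/fsubsetP => a; rewrite !inE /= => /andP[_ /eqP am].
    have [b hb] : exists b : {ffun 'I_d -> 'I_m.+2}, mindex b = a.
      by apply: mindex_lift; rewrite am.
    by apply/imfsetP; exists b => //; apply/eqP; rewrite hb.
  rewrite big_imfset /= => [|b b' _ _]; last exact: mindex_inj.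
  by rewrite big_enum /= lexx.
have c01 : c0 ^+ 2 <= 1.
  have := hS 0%N fset0; rewrite expr0 divr1.
  move/(le_trans (sumr_ge0 _ (fun a _ => normc_ge0 _))).
  by rewrite pmulr_rge0 // subr_ge0.
apply: ge_ereal_sup => _ [X [fX _] <-]; rewrite fsbig_finite //= sumEFin lee_fin.
rewrite (coef_dilate _ hc) ?r_gt0 //.
set D := fset_set X; set M := (\sum_(a <- D) mdeg a)%N.
pose g a := r ^+ mdeg a * normc (c a).
rewrite (eq_bigr g) => [|a _]; last first.
  by rewrite ComplexField.Normc.normcM normcX normc_real gtr0_norm.
have -> : \sum_(a <- D) g a = \sum_(i < M.+1) \sum_(a <- D | mdeg a == i) g a.
  rewrite (exchange_big_dep predT) //=; apply: eq_big_seq => a aD.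
  have aM : (mdeg a < M.+1)%N by rewrite ltnS /M (big_fsetD1 a) //= leq_addr.
  by rewrite (big_pred1 (Ordinal aM)).
rewrite big_ord_recl /=.
have h0 : \sum_(a <- D | mdeg a == 0%N) g a <= c0.
  rewrite big_fset_condE; apply: (@le_trans _ _ (\sum_(a <- [fset [ffun=> 0%N]]%fset) g a)).
    apply: ler_sum_fset => [|a]; last by rewrite /g mulr_ge0 ?normc_ge0 // exprn_ge0 // ltW.
    apply/fsubsetP => a; rewrite !inE /= => /andP[_ /eqP a0].
    apply/eqP/ffunP => j; rewrite ffunE; apply/eqP.
    by rewrite -leqn0 -a0 leq_mdeg.
  by rewrite big_seq_fset1 /g mdeg0 expr0 mul1r.
have h1 : \sum_(i < M) \sum_(a <- D | mdeg a == i.+1) g a <= 2^-1 * (1 - c0 ^+ 2).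
  apply: (@le_trans _ _ (\sum_(i < M) r * kd * (r / p) ^+ i * (1 - c0 ^+ 2))).
    apply: ler_sum => i _.
    rewrite (eq_bigr (fun a => r ^+ i.+1 * normc (c a))) => [|a /eqP ai]; last by rewrite /g ai.
    rewrite -mulr_sumr; apply: le_trans (ler_wpM2l (exprn_ge0 _ (ltW r_gt0)) (hS i D)) _.
    rewrite exprS expr_div_n le_eqVlt; apply/orP; left; apply/eqP.
    by field; rewrite expf_neq0 ?gt_eqF.
  rewrite -mulr_suml; apply: ler_wpM2r; first by rewrite subr_ge0.
  rewrite -mulr_sumr; apply: le_trans half; apply: ler_wpM2l.
    by rewrite mulr_ge0 ?ltW.
  apply: geometric_sum_le; first by rewrite ltW // divr_gt0.
  by rewrite ltr_pdivrMr // mul1r.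
apply: le_trans (lerD h0 h1) _.
have : 0 <= (c0 - 1) ^+ 2 by exact: sqr_ge0.
nra.
Qed.
End BohrSufficient.

Lemma bohr_agler_radius_ge (R : realType) (d : nat) (r : R) : 0 < r < 1 ->
  (forall f : 'rV[R[i]]_d -> R[i], agler_class f -> (norm1 (dilate r f) <= 1)%E) ->
  r <= bohr_agler_radius R d.
Proof.
move=> r01 h; apply: ub_le_sup; last by split.
by exists 1 => x [/andP[_ /ltW]].
Qed.

Lemma expR_ge_sqr (R : realType) (x : R) : 0 <= x -> x ^+ 2 / 4 <= expR x.
Proof.
move=> x0; have h := expR_ge1Dx (x / 2).
have -> : expR x = expR (x / 2) ^+ 2 by rewrite -expRM_natl; congr expR; field.
have : x / 2 <= expR (x / 2) by lra.
by move/(lerXn2r 2); rewrite !nnegrE divr_ge0 ?expR_ge0 // => /(_ isT isT); lra.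
Qed.

(** Take [r = (1 - eps) sqrt (L / d)] with [L = ln d], and
    [s = (1 - eps) L / d = r^2 / (1 - eps)] in [agler_bohr_bound]. Then [r / p]
    is the constant [sqrt (1 - eps)], while [(1 - s)^-d] is at most
    [exp ((1 - eps / 2) L)], so that [r^2 kd^2 <= L exp (- eps L / 2)] tends
    to 0. *)
Lemma bohr_agler_radius_lower (R : realType) (eps : R) : 0 < eps < 1 ->
  exists L0 : R, forall d : nat, L0 <= ln d%:R ->
    (1 - eps) * Num.sqrt (ln d%:R / d%:R) <= bohr_agler_radius R d.
Proof.
move=> /andP[eps0 eps1].
pose q := Num.sqrt (1 - eps).
have q0 : 0 < q by rewrite sqrtr_gt0 subr_gt0.
have q1 : q < 1 by rewrite -sqrtr1 ltr_sqrt // ltrBlDr ltrDl.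
pose delta := (1 - q) / 2; have delta0 : 0 < delta by rewrite divr_gt0 ?subr_gt0.
(* [L >= 8 / eps] gives [s <= eps / 2], and the last term gives
   [L exp (- eps L / 2) <= delta ^+ 2], both through [x^2 / 4 <= exp x]. *)
pose L0 := 1 + 8 / eps + 16 / (eps ^+ 2 * delta ^+ 2).
exists L0 => d; set L := ln _ => hL.
have a0 : 0 < 8 / eps by rewrite divr_gt0.
have b0 : 0 < 16 / (eps ^+ 2 * delta ^+ 2) by rewrite divr_gt0 // mulr_gt0 // exprn_gt0.
have L_ge1 : 1 <= L by rewrite /L0 in hL; lra.
have L_gt0 : 0 < L by lra.
have L8 : 8 / eps <= L by rewrite /L0 in hL; lra.
have L16 : 16 / (eps ^+ 2 * delta ^+ 2) <= L by rewrite /L0 in hL; lra.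
have d_gt0 : (0 < d)%N.
  by case: d @L L_gt0 {hL L_ge1 L8 L16} => //= ; rewrite ln0 ?lexx // ltxx.
have dE : (d%:R : R) = expR L by rewrite lnK // posrE ltr0n.
have dL2 : L ^+ 2 / 4 <= d%:R by rewrite dE expR_ge_sqr // ltW.
have dR0 : 0 < (d%:R : R) by rewrite ltr0n.
have Ld : L / d%:R <= eps / 2.
  rewrite ler_pdivrMr //; apply: (@le_trans _ _ (eps / 2 * (L ^+ 2 / 4))); last first.
    by rewrite ler_pM2l // divr_gt0.
  by rewrite ler_pdivrMr // in L8; nra.
have Ld0 : 0 < L / d%:R by rewrite divr_gt0.
pose s := (1 - eps) * (L / d%:R).
pose r := (1 - eps) * Num.sqrt (L / d%:R).
have sq0 : 0 < Num.sqrt (L / d%:R) by rewrite sqrtr_gt0.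
have sq1 : Num.sqrt (L / d%:R) < 1.
  by rewrite -[ltRHS]sqrtr1 ltr_sqrt ?ltr01 //; apply: le_lt_trans Ld _; lra.
have sqE : Num.sqrt (L / d%:R) ^+ 2 = L / d%:R by rewrite sqr_sqrtr // ltW.
have r0 : 0 < r by rewrite mulr_gt0 ?subr_gt0.
have r1 : r < 1 by rewrite /r; nra.
have s0 : 0 < s by rewrite mulr_gt0 ?subr_gt0.
have s_eps : s <= eps / 2 by rewrite /s; nra.
have s1 : s < 1 by lra.
have pE : Num.sqrt s = q * Num.sqrt (L / d%:R) by rewrite sqrtrM // subr_ge0 ltW.
have qE : q ^+ 2 = 1 - eps by rewrite sqr_sqrtr // subr_ge0 ltW.
have rE : r = q * Num.sqrt s by rewrite pE mulrA -expr2 qE.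
have p0 : 0 < Num.sqrt s by rewrite sqrtr_gt0.
apply: bohr_agler_radius_ge; first by rewrite r0.
move=> f; apply: (agler_bohr_bound (s := s)) => //; first by rewrite s0.
  by rewrite -/r rE; nra.
rewrite -/r.
have -> : r / Num.sqrt s = q by rewrite rE mulfK // gt_eqF.
have q'0 : 0 < 1 - q by rewrite subr_gt0.
rewrite (ler_pdivrMr _ _ q'0) mulrC.
rewrite (_ : 2^-1 * (1 - q) = delta); last by rewrite /delta mulrC.
set kd := Num.sqrt _.
have c0 : 0 < 1 - s by rewrite subr_gt0.
have kd2 : kd ^+ 2 <= expR ((1 - eps / 2) * L).
  rewrite sqr_sqrtr; last by rewrite exprn_ge0 // invr_ge0 ltW.
  apply: (@le_trans _ _ (expR (s / (1 - s)) ^+ d)).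
    rewrite lerXn2r ?nnegrE ?expR_ge0 ?invr_ge0 ?(ltW c0) //.
    apply: le_trans (expR_ge1Dx _).
    by rewrite le_eqVlt; apply/orP; left; apply/eqP; field; rewrite gt_eqF.
  rewrite -expRM_natl ler_expR mulrA ler_pdivrMr // /s.
  rewrite (_ : d%:R * ((1 - eps) * (L / d%:R)) = (1 - eps) * L); last first.
    by field; rewrite gt_eqF.
  have key : 1 - eps <= (1 - eps / 2) * (1 - s) by nra.
  rewrite -/s mulrAC; apply: ler_wpM2r; [exact: ltW|exact: key].
have rkd0 : 0 <= kd * r by rewrite mulr_ge0 ?sqrtr_ge0 ?(ltW r0).
rewrite -(@ler_pXn2r _ 2) // ?nnegrE ?(ltW delta0) // exprMn.
apply: (@le_trans _ _ (expR ((1 - eps / 2) * L) * (L / d%:R))).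
  apply: ler_pM; rewrite ?sqr_ge0 // /r exprMn sqE ler_piMl ?(ltW Ld0) //.
  by rewrite exprn_ile1 //; lra.
rewrite dE mulrCA -expRN -expRD (_ : _ + _ = - (eps / 2 * L)); last by ring.
rewrite expRN -/(L / _) ler_pdivrMr ?expR_gt0 //.
have hx : 0 <= eps / 2 * L by rewrite mulr_ge0 ?divr_ge0 ?ltW.
have hd2 : 0 < delta ^+ 2 by rewrite exprn_gt0.
have := ler_wpM2l (ltW hd2) (expR_ge_sqr hx); apply: le_trans.
rewrite ler_pdivrMr ?mulr_gt0 ?exprn_gt0 // in L16.
nra.
Qed.

(** * Polynomials in the Agler class *)

Lemma has_sum_finite (R : realType) (I : choiceType) (V : zmodType)
    (N : V -> \bar R) (F : I -> V) (D : {fset I}) :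
  (forall e : R, 0 < e -> (N 0%R < e%:E)%E) -> (forall i, i \notin D -> F i = 0) ->
  has_sum N F (\sum_(i <- D) F i).
Proof.
move=> N0 hF e e0; exists D => J sDJ.
by rewrite (big_fset_incl _ sDJ) ?subrr ?N0 // => i _; exact: hF.
Qed.

Section Polynomials.
Variables (R : realType) (d : nat).
Local Notation C := R[i].
Local Notation pol := (seq (C * multi_index d)).
Implicit Types p : pol.

(** A polynomial is a list of terms, possibly with repeated monomials: this
    makes recursive constructions and sums over terms easy, and [pcoef]
    collects the terms when the coefficients are needed. *)
Definition peval p (z : 'rV[C]_d) : C := \sum_(t <- p) t.1 * monomial z t.2.

Definition pcoef p (a : multi_index d) : C := \sum_(t <- p | t.2 == a) t.1.

Definition psupp p : {fset multi_index d} := [fset a in unzip2 p]%fset.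

Lemma pcoef_out p a : a \notin psupp p -> pcoef p a = 0.
Proof.
rewrite inE /= => ap; rewrite /pcoef big_seq_cond big_pred0 // => t.
apply/negP => /andP[tp /eqP ta]; move/negP: ap; apply.
by apply/mapP; exists t.
Qed.

Lemma sum_pcoef (V : lmodType C) p (g : multi_index d -> V) :
  \sum_(a <- psupp p) pcoef p a *: g a = \sum_(t <- p) t.1 *: g t.2.
Proof.
under eq_bigr => a _ do rewrite scaler_suml.
rewrite (exchange_big_dep predT) //= ; apply: eq_big_seq => t tp.
rewrite -big_filter (_ : [seq _ <- _ | _] = [:: t.2]) ?big_seq1 //.
have tD : t.2 \in (psupp p : seq _) by rewrite !inE /= map_f.
by rewrite -(filter_pred1_uniq (fset_uniq (psupp p)) tD); apply: eq_filter => a; rewrite /= eq_sym.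
Qed.

Lemma peval_power_series0 p : power_series_at (peval p) 0 (pcoef p).
Proof.
exists 1 => // z _.
have -> : peval p z = \sum_(a <- psupp p) pcoef p a * monomial (z - 0) a.
  by rewrite subr0 (sum_pcoef p (monomial z : _ -> C^o)).
apply: has_sum_finite => [e e0|a /pcoef_out ->]; last by rewrite mul0r.
by rewrite lte_fin ComplexField.Normc.normc0.
Qed.

Lemma coef_peval p : coef (peval p) = pcoef p.
Proof. exact: coefE (peval_power_series0 p). Qed.

Definition polynomial_fun (g : 'rV[C]_d -> C) := exists p, g = peval p.

Lemma polynomial_cst k : polynomial_fun (fun=> k).
Proof.
exists [:: (k, [ffun=> 0%N])]; apply/funext => z.
rewrite /peval big_seq1 /monomial big1 ?mulr1 // => j _.
by rewrite ffunE expr0.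
Qed.

Lemma polynomial_coord j : polynomial_fun (fun z => z 0 j).
Proof.
exists [:: (1, [ffun i => (i == j : nat)])]; apply/funext => z.
rewrite /peval big_seq1 /monomial mul1r (bigD1 j) //= ffunE eqxx expr1.
by rewrite big1 ?mulr1 // => i /negbTE ij; rewrite ffunE ij expr0.
Qed.

Lemma polynomialD f g : polynomial_fun f -> polynomial_fun g ->
  polynomial_fun (fun z => f z + g z).
Proof.
move=> [p ->] [q ->]; exists (p ++ q); apply/funext => z.
by rewrite /peval big_cat.
Qed.

Lemma polynomialM f g : polynomial_fun f -> polynomial_fun g ->
  polynomial_fun (fun z => f z * g z).
Proof.
move=> [p ->] [q ->].
exists (allpairs (fun t s : C * multi_index d =>
  (t.1 * s.1, [ffun j => (t.2 j + s.2 j)%N])) p q).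
apply/funext => z; rewrite /peval big_allpairs_dep /= mulr_suml.
apply: eq_bigr => t _; rewrite mulr_sumr; apply: eq_bigr => s _ /=.
rewrite mulrACA; congr (_ * _); rewrite /monomial -big_split /=.
by apply: eq_bigr => j _; rewrite ffunE exprD.
Qed.

Lemma polynomial_sum (I : Type) (s : seq I) (F : I -> 'rV[C]_d -> C) :
  (forall i, polynomial_fun (F i)) -> polynomial_fun (fun z => \sum_(i <- s) F i z).
Proof.
move=> hF; elim: s => [|i s IH].
  have -> : (fun z => \sum_(i <- [::]) F i z) = fun=> 0.
    by apply/funext => z; rewrite big_nil.
  exact: polynomial_cst.
have -> : (fun z => \sum_(j <- i :: s) F j z) = fun z => F i z + \sum_(j <- s) F j z.
  by apply/funext => z; rewrite big_cons.
exact: polynomialD.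
Qed.

Lemma polynomial_prod (I : Type) (s : seq I) (F : I -> 'rV[C]_d -> C) :
  (forall i, polynomial_fun (F i)) -> polynomial_fun (fun z => \prod_(i <- s) F i z).
Proof.
move=> hF; elim: s => [|i s IH].
  have -> : (fun z => \prod_(i <- [::]) F i z) = fun=> 1.
    by apply/funext => z; rewrite big_nil.
  exact: polynomial_cst.
have -> : (fun z => \prod_(j <- i :: s) F j z) = fun z => F i z * \prod_(j <- s) F j z.
  by apply/funext => z; rewrite big_cons.
exact: polynomialM.
Qed.

Lemma polynomialX f n : polynomial_fun f -> polynomial_fun (fun z => f z ^+ n).
Proof.
move=> hf; have -> : (fun z => f z ^+ n) = fun z => \prod_(i <- iota 0 n) f z.
  by apply/funext => z; rewrite big_const_seq count_predT size_iota iter_mulr_1.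
exact: polynomial_prod.
Qed.

(** The expansion of a polynomial at [w] is the expansion at 0 of its
    translate, which is again a polynomial function. *)
Lemma peval_analytic p : analytic_on_polydisk (peval p).
Proof.
move=> w _.
have [q hq] : polynomial_fun (fun z => peval p (z + w)).
  apply: polynomial_sum => t; apply: polynomialM; first exact: polynomial_cst.
  apply: polynomial_prod => j; apply: polynomialX.
  have -> : (fun z : 'rV[C]_d => (z + w) 0 j) = fun z => z 0 j + w 0 j.
    by apply/funext => z; rewrite mxE.
  by apply: polynomialD; [exact: polynomial_coord|exact: polynomial_cst].
have [e e0 h] := peval_power_series0 q.
exists (pcoef q), e => // z hz; have := h (z - w).
rewrite subr0 -hq subrK; apply => j; have := hz j.
by rewrite !mxE subr0.
Qed.

Section Operators.
Variables (H : hilbertType R) (T : 'I_d -> {linear H -> H}).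

Definition popr p (x : H) : H := \sum_(t <- p) t.1 *: op_monomial T t.2 x.

Lemma popr_linear p : linear (popr p).
Proof.
move=> k x y; rewrite /popr scaler_sumr -big_split; apply: eq_bigr => t _ /=.
by rewrite op_monomial_is_linear scalerDr !scalerA mulrC.
Qed.

HB.instance Definition _ p := GRing.isLinear.Build C H H _ (popr p) (popr_linear p).

Lemma op_eval_peval p : op_eval (peval p) T (popr p : {linear H -> H}).
Proof.
rewrite /op_eval coef_peval /=.
have -> : popr p = \sum_(a <- psupp p) (fun x => pcoef p a *: op_monomial T a x).
  by apply/funext => x; rewrite fct_sumE (sum_pcoef p (fun a => op_monomial T a x)).
apply: has_sum_finite => [e e0|a /pcoef_out ->]; last first.
  by apply/funext => x; rewrite scale0r.
apply: le_lt_trans (_ : (0%:E < e%:E)%E); last by rewrite lte_fin.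
by apply: opnorm_le => // x; rewrite hnorm0 mul0r.
Qed.

End Operators.

Section ScalarTuple.
Variables (H : hilbertType R) (z : 'rV[C]_d).

Definition scale_tuple (j : 'I_d) : {linear H -> H} := GRing.scale (z 0 j).

Lemma scale_tuple_comm i j x :
  scale_tuple i (scale_tuple j x) = scale_tuple j (scale_tuple i x).
Proof. by rewrite /= !scalerA mulrC. Qed.

Lemma op_monomial_scale a x : op_monomial scale_tuple a x = monomial z a *: x.
Proof.
elim/multi_index_ind: a => [|a j IH].
  rewrite op_monomial0 /monomial big1 ?scale1r // => j _.
  by rewrite ffunE expr0.
rewrite op_monomialS; last exact: scale_tuple_comm.
rewrite IH /= scalerA; congr (_ *: _).
rewrite /monomial [in RHS](bigD1 j) //= [X in _ * X](bigD1 j) //= mulrA.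
rewrite ffunE eqxx addn1 exprS; congr (_ * _); apply: eq_bigr => i /negbTE ij.
by rewrite ffunE ij addn0.
Qed.

End ScalarTuple.

(** Being bounded by 1 on the polydisk is the instance of the hypothesis where
    [T] is the tuple of scalar multiplications by the coordinates of [z]. *)
Lemma peval_agler p :
  (forall (H : hilbertType R) (T : 'I_d -> {linear H -> H}),
    (forall i j x, T i (T j x) = T j (T i x)) ->
    (forall j x, hnorm (T j x) <= hnorm x) ->
    forall x, hnorm (popr T p x) <= hnorm x) ->
  agler_class (peval p).
Proof.
move=> hp; split; last first.
  move=> H T Tc T1; exists (popr T p : {linear H -> H}); first exact: op_eval_peval.
  apply: opnorm_le => // x; rewrite mul1r; apply: hp => // j y.
  by apply: opnorm_le1P; exact: ltW.
split; first exact: peval_analytic.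
move=> z hz; pose H := l2space R unit.
pose T := scale_tuple H z.
pose x : H := [ffun=> 1].
have nx : hnorm x = 1.
  apply/eqP; rewrite -(@eqrXn2 _ 2) ?hnorm_ge0 // expr1n hnorm_l2_sqr.
  rewrite (big_pred1 tt) => [|[] //]; rewrite ffunE ComplexField.Normc.normc1.
  by rewrite expr1n.
have := hp H T (@scale_tuple_comm H z) _ x; rewrite nx => /(_ _) h.
have -> : normc (peval p z) = hnorm (popr T p x); last first.
  apply: h => j y; rewrite hnormZ ler_piMl ?hnorm_ge0 //.
  exact: ltW (hz j).
rewrite (_ : popr T p x = peval p z *: x); first by rewrite hnormZ nx mulr1.
rewrite /popr /peval scaler_suml; apply: eq_bigr => t _.
by rewrite op_monomial_scale scalerA.
Qed.

Lemma pcoef_uniq p t : uniq (unzip2 p) -> t \in p -> pcoef p t.2 = t.1.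
Proof.
elim: p => // s p IH /= /andP[sp up]; rewrite inE /pcoef big_cons.
case/orP => [/eqP ->|tp]; last first.
  case: eqP => [st|_]; last exact: IH.
  by move: sp; rewrite st => /negP []; apply/mapP; exists t.
rewrite eqxx big_seq_cond big_pred0 ?addr0 // => t'.
apply/negP => /andP[tp /eqP ts]; move: sp; rewrite -ts => /negP; apply.
by apply/mapP; exists t'.
Qed.

Lemma norm1_peval_ge p r : uniq (unzip2 p) -> 0 < r < 1 ->
  ((\sum_(t <- p) r ^+ mdeg t.2 * normc t.1)%:E <= norm1 (dilate r (peval p)))%E.
Proof.
move=> up r01; have /andP[r0 r1] := r01.
rewrite /norm1 (coef_dilate r01 (peval_power_series0 p)).
apply: esum_ge; exists [set` unzip2 p]; first by split=> //; exact: finite_seq.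
rewrite -fsbig_seq //= big_map sumEFin lee_fin le_eqVlt; apply/orP; left; apply/eqP.
apply: eq_big_seq => t tp /=.
by rewrite pcoef_uniq // ComplexField.Normc.normcM normcX normc_real gtr0_norm.
Qed.
End Polynomials.

(** * Fourier polynomials *)

Section FourierPolynomial.
Variables (R : realType) (d q m : nat).
Local Notation C := R[i].
Local Notation cR := (real_complex R).
Variables (w : C) (idx : nat -> 'I_q -> 'I_d).
Hypothesis pw : q.-primitive_root w.
Hypothesis idx_inj : forall k l i j, (k < m)%N -> (l < m)%N ->
  idx k i = idx l j -> k = l /\ i = j.

Let u : R := (Num.sqrt q%:R)^-1.
Let q_gt0 : (0 < q)%N := prim_order_gt0 pw.
Let U (i j : nat) : C := cR u * w ^+ (i * j).

(** The entries of the vector [U D_k ... U D_1 (u, ..., u)], where [U] is the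
    unitary matrix of the discrete Fourier transform and [D_k] is the diagonal
    matrix of the [q] fresh variables [idx k.-1 j]. Each monomial picks one
    variable from each block, and no cancellation occurs. *)
Fixpoint fourier_pol (k : nat) (i : 'I_q) : seq (C * multi_index d) :=
  if k is k'.+1 then
    allpairs_dep (fun (j : 'I_q) (t : C * multi_index d) =>
      (U i j * t.1, add1 t.2 (idx k' j))) (enum 'I_q) (fourier_pol k')
  else [:: (cR u, [ffun=> 0%N])].

Let u_ge0 : 0 <= u. Proof. by rewrite invr_ge0 sqrtr_ge0. Qed.

Let u_sqr : u ^+ 2 * q%:R = 1.
Proof.
by rewrite exprVn sqr_sqrtr ?ler0n // mulVf // pnatr_eq0 -lt0n.
Qed.

Lemma fourier_unitary (j l : 'I_q) : \sum_(i < q) U i j * (U i l)^* = (j == l)%:R.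
Proof.
have nw : normc w = 1 := normc_prim_root pw.
have wU : w * w^* = 1 by rewrite -normCK normcE_norm nw expr1n.
have wconj n : (w ^+ (n * l))^* = w ^+ (n * (q - l)).
  have wl : w ^+ (n * l) * (w ^+ (n * l))^* = 1.
    by rewrite rmorphXn /= -exprMn wU expr1n.
  have wl2 : w ^+ (n * l) * w ^+ (n * (q - l)) = 1.
    rewrite -exprD -mulnDr subnKC; last exact: ltnW.
    by rewrite mulnC exprM (prim_expr_order pw) expr1n.
  apply: (mulfI (_ : w ^+ (n * l) != 0)); last by rewrite wl wl2.
  by apply: contra_eq_neq wl2 => ->; rewrite mul0r eq_sym oner_eq0.
have hU (i : 'I_q) : U i j * (U i l)^* = cR (u ^+ 2) * (w ^+ (j + (q - l))) ^+ i.
  rewrite /U rmorphM /= wconj -exprM [((_ + _) * _)%N]mulnC mulnDr exprD.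
  have -> : (cR u)^* = cR u by apply: conj_Creal; apply/complex_realP; exists u.
  by rewrite rmorphXn /=; ring.
under eq_bigr do rewrite hU.
rewrite -mulr_sumr (sum_prim_root _ pw).
have -> : (q %| j + (q - l))%N = (j == l).
  apply/idP/eqP => [|->]; last by rewrite subnKC ?dvdnn // ltnW.
  by rewrite addnC => /(dvdn_shift_eq (ltn_ord l) (ltn_ord j)) /val_inj.
case: eqP => _; rewrite ?mulr0 //.
by rewrite -(rmorph_nat (real_complex R)) -rmorphM u_sqr.
Qed.

Lemma popr_fourierS (H : hilbertType R) (T : 'I_d -> {linear H -> H}) k i x :
  (forall i j x, T i (T j x) = T j (T i x)) ->
  popr T (fourier_pol k.+1 i) x =
  \sum_(j < q) U i j *: T (idx k j) (popr T (fourier_pol k j) x).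
Proof.
move=> Tc; rewrite /popr /= big_allpairs_dep /= big_enum /=; apply: eq_bigr => j _.
rewrite linear_sum scaler_sumr; apply: eq_bigr => t _ /=.
by rewrite op_monomialS // linearZ /= scalerA.
Qed.

(** A unitary matrix of scalars acts isometrically on the direct sum of [q]
    copies of any Hilbert space. *)
Lemma fourier_isometry (H : hilbertType R) (y : 'I_q -> H) :
  \sum_(i < q) hnorm (\sum_(j < q) U i j *: y j) ^+ 2 = \sum_(j < q) hnorm (y j) ^+ 2.
Proof.
apply: (@complexI R); rewrite !rmorph_sum /=.
under eq_bigr do rewrite hnorm_sqrE linear_sumlz.
under [RHS]eq_bigr do rewrite hnorm_sqrE.
rewrite exchange_big /=; apply: eq_bigr => j _.
under eq_bigr do rewrite linear_sumr.
rewrite exchange_big /= (bigD1 j) //= [X in _ + X]big1 ?addr0.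
  under eq_bigr do rewrite linearZl_LR /= linearZr_LR /= mulrA.
  by rewrite -mulr_suml fourier_unitary eqxx mul1r.
move=> l lj; under eq_bigr do rewrite linearZl_LR /= linearZr_LR /= mulrA.
by rewrite -mulr_suml fourier_unitary eq_sym (negbTE lj) mul0r.
Qed.

(** Diagonal matrices of contractions are contractions, and [u = q^(-1/2)]
    makes the initial vector [(u x, ..., u x)] as long as [x]. *)
Lemma popr_fourier_le (H : hilbertType R) (T : 'I_d -> {linear H -> H}) k x :
  (forall i j x, T i (T j x) = T j (T i x)) ->
  (forall j x, hnorm (T j x) <= hnorm x) ->
  \sum_(i < q) hnorm (popr T (fourier_pol k i) x) ^+ 2 <= hnorm x ^+ 2.
Proof.
move=> Tc T1; elim: k => [|k IH].
  under eq_bigr do rewrite /popr big_seq1 /= op_monomial0 hnormZ normc_real ger0_norm //.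
  by rewrite sumr_const card_ord -[leLHS]mulr_natl exprMn mulrA [_ * u ^+ 2]mulrC u_sqr mul1r.
under eq_bigr do rewrite popr_fourierS //.
rewrite fourier_isometry; apply: le_trans IH; apply: ler_sum => j _.
by rewrite ler_pXn2r ?nnegrE ?hnorm_ge0.
Qed.

Lemma fourier_agler k i : agler_class (peval (fourier_pol k i)).
Proof.
apply: peval_agler => H T Tc T1 x.
rewrite -(@ler_pXn2r _ 2) // ?nnegrE ?hnorm_ge0 //.
apply: le_trans (popr_fourier_le k x Tc T1).
by rewrite (bigD1 i) //= lerDl sumr_ge0 // => j _; exact: sqr_ge0.
Qed.

Lemma fourier_pol_mem k i t : t \in fourier_pol k.+1 i ->
  exists j s, s \in fourier_pol k j /\ t = (U i j * s.1, add1 s.2 (idx k j)).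
Proof.
by case/allpairsPdep => j [t' [_ t'P ->]]; exists j, t'.
Qed.

Lemma normc_fourier k i t : t \in fourier_pol k i ->
  normc t.1 = u ^+ k.+1 /\ mdeg t.2 = k.
Proof.
elim: k i t => [|k IH] i t.
  rewrite inE => /eqP ->; rewrite normc_real ger0_norm //= expr1; split=> //.
  exact: mdeg0.
move=> /fourier_pol_mem [j [s [/IH [h1 h2] ->]]] /=; rewrite mdeg_add1 h2; split=> //.
rewrite ComplexField.Normc.normcM h1 ComplexField.Normc.normcM normcX.
by rewrite (normc_prim_root pw) expr1n mulr1 normc_real ger0_norm // -exprS.
Qed.

Lemma size_fourier k i : size (fourier_pol k i) = (q ^ k)%N.
Proof.
elim: k i => //= k IH i; rewrite size_allpairs_dep.
rewrite (eq_map (g := fun=> (q ^ k)%N)) => [|j /=]; last exact: IH.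
by rewrite sumnE big_map big_enum /= sum_nat_const card_ord expnS.
Qed.

Lemma fourier_fresh k i t l j : (k <= l < m)%N ->
  t \in fourier_pol k i -> t.2 (idx l j) = 0%N.
Proof.
elim: k i t => [|k IH] i t /andP[kl lm].
  by rewrite inE => /eqP ->; rewrite ffunE.
move=> /fourier_pol_mem [j' [s [sP ->]]] /=.
rewrite ffunE (IH _ _ _ sP) ?(ltnW kl) //; case: eqP => //= h.
by have [lk _] := idx_inj lm (ltn_trans kl lm) h; move: kl; rewrite lk ltnn.
Qed.

(** The variable chosen at step [k] can be read off from the monomial because
    the block [idx k] is fresh. *)
Lemma fourier_uniq k i : (k <= m)%N -> uniq (unzip2 (fourier_pol k i)).
Proof.
elim: k i => //= k IH i km; rewrite /unzip2 map_allpairs.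
have IHk j := IH j (ltnW km).
apply: allpairs_uniq_dep => [|j _|p1 p2].
- exact: enum_uniq.
- exact: map_uniq (IHk j).
case/allpairsPdep => j [t [_ tP ->]]; case/allpairsPdep => l [s [_ sP ->]] /= h.
have jl : j = l.
  apply/eqP; apply: contraT => jl; have := congr1 (fun a : multi_index d => a (idx k j)) h.
  rewrite /= !ffunE (fourier_fresh _ _ tP) ?leqnn // (fourier_fresh _ _ sP) ?leqnn // eqxx.
  by case: eqP => // e; have [_ /eqP] := idx_inj km km e; rewrite (negbTE jl).
move: sP h; rewrite -jl => sP /add1_inj h; congr existT.
have h1 := pcoef_uniq (IHk j) tP; have h2 := pcoef_uniq (IHk j) sP.
by move: h1 h2; rewrite h => ->; case: (t) (s) h => ? ? [? ?] /= -> ->.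
Qed.

Lemma norm1_fourier_ge i r : 0 < r < 1 ->
  ((r ^+ m * (q%:R ^+ m * u ^+ m.+1))%:E <= norm1 (dilate r (peval (fourier_pol m i))))%E.
Proof.
move=> r01; apply: le_trans (norm1_peval_ge (fourier_uniq i (leqnn m)) r01).
rewrite lee_fin le_eqVlt; apply/orP; left; apply/eqP.
rewrite (eq_big_seq (fun=> r ^+ m * u ^+ m.+1)) => [|t /normc_fourier [-> ->]] //.
rewrite big_const_seq count_predT iter_addr_0 size_fourier -[RHS]mulr_natl natrX.
by rewrite mulrCA.
Qed.
End FourierPolynomial.

(** * The upper bound for the radius and the asymptotics *)

(** The supremum of the empty set is 0 by convention, hence [0 <= M]. *)
Lemma bohr_agler_radius_le (R : realType) (d : nat) (M : R) : 0 <= M ->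
  (forall r : R, 0 < r < 1 ->
     (forall f : 'rV[R[i]]_d -> R[i], agler_class f -> (norm1 (dilate r f) <= 1)%E) ->
     r <= M) ->
  bohr_agler_radius R d <= M.
Proof.
move=> M0 h; rewrite /bohr_agler_radius; set S := [set r | _].
have [->|S0] := eqVneq S set0; first by rewrite sup0.
apply: ge_sup; first exact/set0P.
by move=> r [r01 hr]; exact: h.
Qed.

(** The Fourier polynomial has [q ^ m] coefficients of modulus
    [q^(-(m + 1) / 2)] in degree [m], so [r] is at most the [m]-th root of
    [q^((1 - m) / 2)]. Allowing spare variables, [q * m <= d], avoids having to
    prove that the radius decreases with the dimension. *)
Lemma bohr_agler_radius_powR (R : realType) (d q m : nat) :
  (0 < q)%N -> (0 < m)%N -> (q * m <= d)%N ->
  bohr_agler_radius R d <= (q%:R : R) `^ ((2 * m%:R)^-1 - 2^-1).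
Proof.
move=> q0 m0 qmd; apply: bohr_agler_radius_le => [|r r01 hr]; first exact: powR_ge0.
have d0 : (0 < d)%N by apply: leq_trans qmd; rewrite muln_gt0 q0.
case: d qmd hr d0 => // d qmd hr _.
have [w pw] := complex_prim_root_exists R q0.
pose idx (k : nat) (j : 'I_q) : 'I_d.+1 := inord (k * q + j).
have idxE k j : (k < m)%N -> idx k j = (k * q + j)%N :> nat.
  move=> km; rewrite inordK //; apply: leq_trans qmd.
  apply: (@leq_trans (k.+1 * q)); first by rewrite mulSn addnC ltn_add2r.
  by rewrite mulnC leq_mul2l km orbT.
have idx_inj k l i j : (k < m)%N -> (l < m)%N -> idx k i = idx l j -> k = l /\ i = j.
  move=> km lm /(congr1 val) /=; rewrite !idxE // => h.
  have hk := congr1 (divn^~ q) h; rewrite !divnMDl // !divn_small // !addn0 in hk.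
  by split=> //; apply/val_inj; move: h; rewrite hk => /addnI.
have := le_trans (norm1_fourier_ge pw idx_inj (Ordinal q0) r01)
  (hr _ (fourier_agler idx pw m (Ordinal q0))).
rewrite lee_fin => h; have /andP[r0 _] := r01.
have qR0 : 0 < (q%:R : R) by rewrite ltr0n.
set l := ln (q%:R : R); have qE : (q%:R : R) = expR l by rewrite lnK.
have uE : (Num.sqrt (q%:R : R))^-1 = expR (- (l / 2)).
  rewrite expRN; congr (_^-1); rewrite qE.
  rewrite -[RHS]ger0_norm ?expR_ge0 // -sqrtr_sqr -expRM_natl.
  by congr (Num.sqrt (expR _)); field.
rewrite /powR gt_eqF // -/l.
rewrite -(@ler_pXn2r _ m) // ?nnegrE ?expR_ge0 ?(ltW r0) //.
move: h; rewrite uE {1}qE -!expRM_natl -expRD -ler_pdivlMr ?expR_gt0 // => /le_trans; apply.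
rewrite mul1r -expRN ler_expR -natr1 le_eqVlt; apply/orP; left; apply/eqP.
by field; rewrite pnatr_eq0 -lt0n.
Qed.

Lemma near_ln_ge (R : realType) (L0 : R) : \forall d \near \oo, L0 <= ln (d%:R : R).
Proof.
have := nbhs_infty_ger (expR L0); apply: filterS => d hd.
by rewrite -[L0]expRK ler_ln // ?posrE ?expR_gt0 //; apply: lt_le_trans hd; exact: expR_gt0.
Qed.

(** The exponent [(1 / m - 1) / 2 * ln q] is optimized by [m] close to
    [L = ln d] and [q] close to [d / m]; rounding both down costs a term of
    order [1 / L] in the exponent, through [L / m <= 1 + 2 / L] and
    [ln q >= L - ln L - 2 m / d]. *)
Lemma bohr_agler_radius_upper (R : realType) (d : nat) : (8 : R) <= ln d%:R ->
  bohr_agler_radius R d <=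
    expR (2^-1) * Num.sqrt (ln d%:R / d%:R) * expR (5 * (ln d%:R)^-1).
Proof.
set L := ln _ => L8.
have L0 : 0 < L by lra.
have d_gt0 : (0 < d)%N.
  by case: d @L L8 L0 => //= ; rewrite ln0 ?lexx // ltxx.
have dR0 : 0 < (d%:R : R) by rewrite ltr0n.
have dE : (d%:R : R) = expR L by rewrite lnK // posrE ltr0n.
have dL2 : L ^+ 2 / 4 <= d%:R by rewrite dE expR_ge_sqr // ltW.
have Ld : L / d%:R <= 4 / L.
  by rewrite ler_pdivrMr // mulrAC ler_pdivlMr //; nra.
have LV : L^-1 <= 8^-1 by rewrite lef_pV2 // posrE.
pose m := Num.trunc L.
have /andP[mL Lm] : (m%:R <= L) && (L < m.+1%:R) by exact/truncn_itv/ltW.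
rewrite -natr1 in Lm.
have m7 : 7 <= (m%:R : R) by lra.
have m0 : (0 < m)%N by rewrite -(ltr0n R); lra.
have md : (m <= d)%N by rewrite -(ler_nat R); apply: le_trans mL _; nra.
pose q := (d %/ m)%N.
have q0 : (0 < q)%N by rewrite divn_gt0.
have := @bohr_agler_radius_powR R d q m q0 m0 (leq_divM _ _).
move=> /le_trans; apply.
have qR0 : 0 < (q%:R : R) by rewrite ltr0n.
have qm : (d%:R - m%:R : R) <= q%:R * m%:R.
  rewrite -natrM lerBlDr -natrD ler_nat -mulSnr; apply: ltnW; exact: ltn_ceil.
pose x : R := m%:R / d%:R.
have x0 : 0 <= x by rewrite divr_ge0.
have xL : x <= 4 / L by apply: le_trans Ld; rewrite ler_pM2r // invr_gt0.
have x2 : x <= 2^-1 by lra.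
have lnq : L - ln L - 2 * x <= ln q%:R.
  rewrite -[leLHS]expRK ler_ln ?posrE ?expR_gt0 //.
  rewrite !expRD !expRN lnK ?posrE // -dE.
  have e1 : (expR (2 * x))^-1 <= 1 - x.
    have h1 := expR_ge1Dx (2 * x).
    have h2 : 0 < 1 - x by lra.
    rewrite -[leRHS]invrK lef_pV2 ?posrE ?expR_gt0 ?invr_gt0 //.
    apply: le_trans h1; rewrite -[leLHS]mul1r ler_pdivrMr //; nra.
  apply: (@le_trans _ _ (d%:R / L * (1 - x))).
    by rewrite ler_pM2l // divr_gt0.
  rewrite mulrAC ler_pdivrMr //.
  have -> : d%:R * (1 - x) = d%:R - m%:R by rewrite /x; field; rewrite gt_eqF.
  by apply: le_trans qm _; rewrite ler_pM2l.
have sqE : Num.sqrt (L / d%:R) = expR ((ln L - L) / 2).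
  rewrite -[RHS]ger0_norm ?expR_ge0 // -sqrtr_sqr -expRM_natl.
  rewrite (_ : 2 * _ = ln L - L); last by field.
  by rewrite expRD lnK ?posrE // expRN dE.
rewrite /powR gt_eqF // sqE -!expRD ler_expR.
pose y : R := m%:R^-1.
have m_gt0 : 0 < (m%:R : R) by rewrite ltr0n.
have y0 : 0 < y by rewrite invr_gt0.
have y1 : y <= 1 by rewrite invf_le1 //; lra.
have -> : (2 * m%:R)^-1 - 2^-1 = - ((1 - y) / 2) by rewrite /y; field; rewrite gt_eqF.
have lnL0 : 0 <= ln L by rewrite ln_ge0 //; lra.
have LVE : L * L^-1 = 1 by rewrite mulfV ?gt_eqF.
have LV0 : 0 < L^-1 by rewrite invr_gt0.
have yL : y * L <= 1 + 2 * L^-1.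
  rewrite /y mulrC ler_pdivrMr //; nra.
have h1 : - ((1 - y) / 2) * ln q%:R <= - ((1 - y) / 2) * (L - ln L - 2 * x).
  by rewrite ler_wnM2l //; lra.
apply: le_trans h1 _.
have h3 : 0 <= y * ln L by rewrite mulr_ge0 // ltW.
have h4 : 0 <= y * x by rewrite mulr_ge0 // ltW.
lra.
Qed.

Lemma limn_esup_le (R : realType) (u : nat -> \bar R) (l : \bar R) :
  (\forall n \near \oo, (u n <= l)%E) -> (limn_esup u <= l)%E.
Proof.
move=> h; rewrite /limn_esup /limf_esup.
apply: (@le_trans _ _ (ereal_sup (u @` [set n | (u n <= l)%E]))).
  by apply: ereal_inf_lbound; exists [set n | (u n <= l)%E].
by apply: ge_ereal_sup => _ [n /= hn <-].
Qed.

Lemma limn_einf_ge (R : realType) (u : nat -> \bar R) (l : \bar R) :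
  (\forall n \near \oo, (l <= u n)%E) -> (l <= limn_einf u)%E.
Proof.
move=> h; rewrite -leeN2 -limn_esupN; apply: limn_esup_le.
by apply: filterS h => n hn; rewrite leeN2.
Qed.

Lemma limn_esup_radius (R : realType) :
  (limn_esup (fun d : nat => (bohr_agler_radius R d / Num.sqrt (ln d%:R / d%:R))%:E)
     <= (expR (2^-1))%:E)%E.
Proof.
apply/lee_addgt0Pr => e e0; rewrite -EFinD; apply: limn_esup_le.
set c := expR (2^-1); have c0 : 0 < c by exact: expR_gt0.
pose delta := ln (1 + e / c).
have ec : 0 < e / c by rewrite divr_gt0.
have delta0 : 0 < delta by rewrite ln_gt0 // ltrDl.
have := near_ln_ge (Num.max 8 (5 / delta)); apply: filterS => d.
rewrite ge_max => /andP[L8 Ld]; rewrite lee_fin.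
have L0 : 0 < ln (d%:R : R) by lra.
have d_gt0 : 0 < (d%:R : R).
  by rewrite ltr0n; case: d L0 {L8 Ld} => //=; rewrite ln0 // ltxx.
have s0 : 0 < Num.sqrt (ln (d%:R : R) / d%:R) by rewrite sqrtr_gt0 divr_gt0.
rewrite ler_pdivrMr //; apply: le_trans (bohr_agler_radius_upper L8) _.
rewrite mulrAC ler_pM2r //.
have -> : c + e = c * expR delta.
  by rewrite lnK ?posrE ?addr_gt0 //; field; rewrite gt_eqF.
rewrite ler_pM2l // ler_expR ler_pdivrMr // mulrC -ler_pdivrMr //.
Qed.

Lemma limn_einf_radius (R : realType) :
  (1 <= limn_einf (fun d : nat => (bohr_agler_radius R d / Num.sqrt (ln d%:R / d%:R))%:E))%E.
Proof.
apply/lee_subgt0Pr => e e0.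
pose eps := Num.min e 2^-1.
have eps01 : 0 < eps < 1 by rewrite lt_min e0 /= gt_min invf_lt1 ?ltr1n ?orbT // invr_gt0 ltr0n.
have [L0 hL0] := bohr_agler_radius_lower eps01.
apply: (@le_trans _ _ (1 - eps)%:E).
  by rewrite -EFinB lee_fin lerB // ge_min lexx.
apply: limn_einf_ge; have := near_ln_ge (Num.max 1 L0); apply: filterS => d.
rewrite ge_max => /andP[L1 Ld]; rewrite lee_fin.
have L_gt0 : 0 < ln (d%:R : R) by lra.
have d_gt0 : 0 < (d%:R : R).
  by rewrite ltr0n; case: d L_gt0 {L1 Ld} => //=; rewrite ln0 // ltxx.
by rewrite ler_pdivlMr ?sqrtr_gt0 ?divr_gt0 // hL0.
Qed.

Theorem theorem1p4 (R : realType) :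
  [/\ forall q m : nat, (0 < q)%N -> (0 < m)%N ->
        bohr_agler_radius R (q * m) <= (q%:R : R) `^ ((2 * m%:R)^-1 - 2^-1),
      exists h : nat -> R,
        h =O_\oo (fun d : nat => (ln (d%:R : R))^-1) /\
        \forall d \near \oo,
          bohr_agler_radius R d
            <= expR (2^-1) * Num.sqrt (ln d%:R / d%:R) * expR (h d)
    & let u := fun d : nat =>
        (bohr_agler_radius R d / Num.sqrt (ln d%:R / d%:R))%:E in
      [/\ (1 <= limn_einf u)%E,
          (limn_einf u <= limn_esup u)%E
        & (limn_esup u <= (expR (2^-1))%:E)%E]].
Proof.
split=> [q m q0 m0||u].
- exact: bohr_agler_radius_powR.
- exists (fun d => 5 * (ln d%:R)^-1); split.
    apply/eqO_exP; exists 5 => //; near=> d; rewrite normrM ger0_norm //.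
  by apply: filterS (near_ln_ge (8 : R)) => d; exact: bohr_agler_radius_upper.
- split; [exact: limn_einf_radius|exact: limn_einf_sup|exact: limn_esup_radius].
Unshelve. all: by end_near.
Qed.
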